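(* Let $k$ be a field, $S=k[x_1,\dots,x_n]$, let $\Delta$ be a simplicial complex on $[n]$, and let $m\ge1$ be an integer. If $I_\Delta^{(t)}$ is Cohen-Macaulay for some integer $t\ge(m-1)^2+1$, then $I_\Delta^{(m)}$ is Cohen-Macaulay.
   Context: $[n]=\{1,\dots,n\}$. A simplicial complex on $[n]$ is a collection of subsets of $[n]$ containing $\emptyset$ and closed under taking subsets; $\mathcal F(\Delta)$ is its set of facets (maximal faces). $P_F$ is the prime ideal of $S$ generated by the $x_i$ with $i\notin F$; $I_\Delta=\bigcap_{F\in\mathcal F(\Delta)}P_F$ is the Stanley-Reisner ideal and $I_\Delta^{(m)}=\bigcap_{F\in\mathcal F(\Delta)}P_F^m$ its $m$-th symbolic power. An ideal $I$ is Cohen-Macaulay if $S/I$ is Cohen-Macaulay. *)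

(* Defs.v *)
From HB Require Import structures.
From mathcomp Require Import all_boot all_order all_algebra.
From mathcomp Require Import generic_quotient ring_quotient.
From mathcomp Require Import ring.
From mathcomp Require Import boolp.
From mathcomp Require mpoly.

Set Implicit Arguments.
Unset Strict Implicit.
Unset Printing Implicit Defensive.

Import GRing.Theory.
Local Open Scope ring_scope.
Local Open Scope quotient_scope.

(* MathComp's [idealr R] (proper ideals) and [prime_idealr R] are boolean
   predicates; classically these are arbitrary proper, resp. prime, ideals. *)

Section Localization.

Variables (R : comNzRingType) (p : prime_idealr R).

Lemma prime_notinM (s t : R) : s \notin p -> t \notin p -> s * t \notin p.
Proof.
by move=> sp tp; rewrite prime_idealrM negb_or sp.
Qed.

Lemma prime_notin1 : (1 : R) \notin p.
Proof. by rewrite (@idealr1 _ p). Qed.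

Record loc_frac := LocFrac { loc_pair :> R * R; _ : loc_pair.2 \notin p }.

HB.instance Definition _ := [isSub for loc_pair].
HB.instance Definition _ := [Choice of loc_frac by <:].

Implicit Types x y z : loc_frac.

Lemma loc_frac_den x : x.2 \notin p. Proof. by case: x. Qed.

Definition loc_equiv x y : bool :=
  `[< exists2 s : R, s \notin p & s * (x.1 * y.2 - y.1 * x.2) = 0 >].

Lemma loc_equivP x y :
  reflect (exists2 s : R, s \notin p & s * (x.1 * y.2) = s * (y.1 * x.2))
          (loc_equiv x y).
Proof.
apply: (iffP (asboolP _)) => -[s sp e]; exists s => //.
  by apply/eqP; rewrite -subr_eq0 -mulrBr e.
by rewrite mulrBr e subrr.
Qed.

Lemma loc_equiv_refl : reflexive loc_equiv.
Proof. by move=> x; apply/loc_equivP; exists 1 => //; exact: prime_notin1. Qed.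

Lemma loc_equiv_sym : symmetric loc_equiv.
Proof.
by move=> x y; apply/loc_equivP/loc_equivP => -[s sp e]; exists s.
Qed.

Lemma loc_equiv_trans : transitive loc_equiv.
Proof.
move=> y x z /loc_equivP[s sp e] /loc_equivP[t tp f]; apply/loc_equivP.
exists (s * t * y.2); first by rewrite !prime_notinM ?loc_frac_den.
rewrite [LHS](_ : _ = t * z.2 * (s * (x.1 * y.2))); last by ring.
rewrite e [LHS](_ : _ = s * x.2 * (t * (y.1 * z.2))); last by ring.
by rewrite f; ring.
Qed.

Canonical loc_equiv_equiv :=
  EquivRel loc_equiv loc_equiv_refl loc_equiv_sym loc_equiv_trans.

(* The localization of R at the prime ideal p. *)
Definition localization := {eq_quot loc_equiv}.

HB.instance Definition _ : EqQuotient _ loc_equiv localization :=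
  EqQuotient.on localization.
HB.instance Definition _ := Choice.on localization.

Definition loc_add_frac x y : loc_frac :=
  @LocFrac (x.1 * y.2 + y.1 * x.2, x.2 * y.2)
    (prime_notinM (loc_frac_den x) (loc_frac_den y)).
Definition loc_mul_frac x y : loc_frac :=
  @LocFrac (x.1 * y.1, x.2 * y.2)
    (prime_notinM (loc_frac_den x) (loc_frac_den y)).
Definition loc_opp_frac x : loc_frac := @LocFrac (- x.1, x.2) (loc_frac_den x).
Definition loc_const (r : R) : loc_frac := @LocFrac (r, 1) prime_notin1.

Definition loc_add := lift_op2 localization loc_add_frac.
Definition loc_mul := lift_op2 localization loc_mul_frac.
Definition loc_opp := lift_op1 localization loc_opp_frac.
Definition loc_zero : localization := lift_cst localization (loc_const 0).
Definition loc_one : localization := lift_cst localization (loc_const 1).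

Lemma loc_pi_add :
  {morph \pi_localization : x y / loc_add_frac x y >-> loc_add x y}.
Proof.
move=> x y; unlock loc_add; apply/eqmodP/loc_equivP => /=.
have /eqmodP/loc_equivP[s sp e] := esym (reprK (\pi_localization x)).
have /eqmodP/loc_equivP[t tp f] := esym (reprK (\pi_localization y)).
exists (s * t); first exact: prime_notinM.
move: e f; set x' := repr (\pi x); set y' := repr (\pi y) => e f.
rewrite [LHS](_ : _ = t * y.2 * y'.2 * (s * (x.1 * x'.2))
   + s * x.2 * x'.2 * (t * (y.1 * y'.2))); last by ring.
by rewrite e f; ring.
Qed.
Canonical loc_pi_add_morph := PiMorph2 loc_pi_add.

Lemma loc_pi_mul :
  {morph \pi_localization : x y / loc_mul_frac x y >-> loc_mul x y}.
Proof.
move=> x y; unlock loc_mul; apply/eqmodP/loc_equivP => /=.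
have /eqmodP/loc_equivP[s sp e] := esym (reprK (\pi_localization x)).
have /eqmodP/loc_equivP[t tp f] := esym (reprK (\pi_localization y)).
exists (s * t); first exact: prime_notinM.
move: e f; set x' := repr (\pi x); set y' := repr (\pi y) => e f.
rewrite [LHS](_ : _ = (s * (x.1 * x'.2)) * (t * (y.1 * y'.2))); last by ring.
by rewrite e f; ring.
Qed.
Canonical loc_pi_mul_morph := PiMorph2 loc_pi_mul.

Lemma loc_pi_opp :
  {morph \pi_localization : x / loc_opp_frac x >-> loc_opp x}.
Proof.
move=> x; unlock loc_opp; apply/eqmodP/loc_equivP => /=.
have /eqmodP/loc_equivP[s sp e] := esym (reprK (\pi_localization x)).
exists s => //; move: e; move: (repr _) => x' e.
by rewrite !mulNr !mulrN e.
Qed.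
Canonical loc_pi_opp_morph := PiMorph1 loc_pi_opp.

Canonical loc_pi_zero_morph := PiConst loc_zero.
Canonical loc_pi_one_morph := PiConst loc_one.

Local Ltac loc_ring :=
  rewrite ?piE; apply/eqmodP/loc_equivP; exists 1;
  [exact: prime_notin1 | rewrite /=; ring].

Lemma loc_addA : associative loc_add.
Proof. by elim/quotW => x; elim/quotW => y; elim/quotW => z; loc_ring. Qed.

Lemma loc_addC : commutative loc_add.
Proof. by elim/quotW => x; elim/quotW => y; loc_ring. Qed.

Lemma loc_add0 : left_id loc_zero loc_add.
Proof. by elim/quotW => x; loc_ring. Qed.

Lemma loc_addN : left_inverse loc_zero loc_opp loc_add.
Proof. by elim/quotW => x; loc_ring. Qed.

Lemma loc_mulA : associative loc_mul.
Proof. by elim/quotW => x; elim/quotW => y; elim/quotW => z; loc_ring. Qed.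

Lemma loc_mulC : commutative loc_mul.
Proof. by elim/quotW => x; elim/quotW => y; loc_ring. Qed.

Lemma loc_mul1 : left_id loc_one loc_mul.
Proof. by elim/quotW => x; loc_ring. Qed.

Lemma loc_mulD : left_distributive loc_mul loc_add.
Proof. by elim/quotW => x; elim/quotW => y; elim/quotW => z; loc_ring. Qed.

Lemma loc_one_neq0 : loc_one != loc_zero.
Proof.
rewrite /loc_one /loc_zero -!lock; apply/negP => /eqP/eqmodP/loc_equivP[s sp] /=.
by rewrite mul0r !mulr1 mulr0 => s0; move: sp; rewrite s0 rpred0.
Qed.

HB.instance Definition _ :=
  GRing.isZmodule.Build localization loc_addA loc_addC loc_add0 loc_addN.
HB.instance Definition _ := GRing.Zmodule_isComNzRing.Build localization
  loc_mulA loc_mulC loc_mul1 loc_mulD loc_one_neq0.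

End Localization.

Section CohenMacaulay.

Variable R : comNzRingType.

Definition ideal_gen (A : R -> Prop) : {pred R} :=
  [pred f | `[< exists2 s : seq (R * R),
     (forall x, x \in s -> A x.2) & f = \sum_(x <- s) x.1 * x.2 >]].

Definition ideal_pow (I : {pred R}) (m : nat) : {pred R} :=
  ideal_gen (fun g => exists2 s : m.-tuple R, {subset s <= I} &
                                              g = \prod_(a <- s) a).

Definition maximal_ideal (M : idealr R) : Prop :=
  forall J : idealr R, {subset M <= J} -> {subset J <= M}.

Definition unique_maximal_ideal (M : idealr R) : Prop :=
  maximal_ideal M /\ forall N : idealr R, maximal_ideal N -> N =i M.

Definition prime_chain (d : nat) : Prop :=
  exists c : 'I_d.+1 -> prime_idealr R, forall i j : 'I_d.+1, (i < j)%N ->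
    {subset c i <= c j} /\ ~ {subset c j <= c i}.

Definition has_krull_dim (d : nat) : Prop :=
  prime_chain d /\ ~ prime_chain d.+1.

Definition regular_sequence (s : seq R) : Prop :=
  (forall i, (i < size s)%N ->
     let I := ideal_gen (fun a => a \in take i s) in
     forall f, f * s`_i \in I -> f \in I) /\
  1 \notin ideal_gen (fun a => a \in s).

Definition has_depth (M : idealr R) (d : nat) : Prop :=
  (exists s, [/\ regular_sequence s, {subset s <= M} & size s = d]) /\
  (forall s, regular_sequence s -> {subset s <= M} -> (size s <= d)%N).

Definition local_cohen_macaulay : Prop :=
  exists M : idealr R, unique_maximal_ideal M /\
    exists d, has_krull_dim d /\ has_depth M d.

End CohenMacaulay.

(* Intended for Noetherian R. *)
Definition cohen_macaulay (R : comNzRingType) : Prop :=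
  forall p : prime_idealr R, maximal_ideal p ->
    local_cohen_macaulay (localization p).

(* I is a proper ideal and R / I is Cohen-Macaulay.  The existential only
   packages I as an [idealr], as required by [{ideal_quot _}]. *)
Definition cohen_macaulay_ideal (R : comNzRingType) (I : {pred R}) : Prop :=
  exists2 J : idealr R, J =i I & cohen_macaulay {ideal_quot J}.

Import mpoly.

Section StanleyReisner.

Variables (k : fieldType) (n : nat).
Implicit Types (D : {set {set 'I_n}}) (F : {set 'I_n}).

Definition simplicial_complex D : Prop :=
  set0 \in D /\ forall F G : {set 'I_n}, F \in D -> G \subset F -> G \in D.

Definition facets D : {set {set 'I_n}} := [set F | maxset (mem D) F].

Definition face_prime F : {pred {mpoly k[n]}} :=
  ideal_gen (fun f => exists2 i, i \notin F & f = 'X_i).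

(* The Stanley-Reisner ideal itself is the case m = 1. *)
Definition symbolic_power D (m : nat) : {pred {mpoly k[n]}} :=
  [pred f | [forall F in facets D, f \in ideal_pow (face_prime F) m]].

End StanleyReisner.

(* Main.v *)
Require Import Defs.
From HB Require Import structures.
From mathcomp Require Import all_boot all_order all_algebra.
From mathcomp Require Import generic_quotient ring_quotient.
From mathcomp Require Import ring zify.
From mathcomp Require Import boolp.
From mathcomp Require Import mpoly.

(** The theorem is a splitting argument.  Write I(t) for the t-th symbolic power
and let P be a maximal ideal of S = k[x_1, .., x_n] that contains I(m).  Raising
to the q-th power those variables that lie in P, and fixing the others, defines
a ring endomorphism phi of S ([dilate_poly]).  It has a one-sided inverse psi
([shrink_poly]) that is linear along phi, psi (phi f * g) = f * psi g, and keeps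
only the monomials in the image of phi.  A monomial x^a lies in I(t) iff for
every facet F its total exponent over the complement of F is at least t.  For a
facet F with P_F inside P this total exponent is multiplied by q under phi, and
for the other facets it can be made large by a monomial outside P.  So, near P,
phi maps I(m) into I(t) as soon as t <= q m, and psi maps I(t) into I(m) as soon
as q (m - 1) < t: then S / I(m) is, near P, a direct summand of S / I(t) along
phi.  The intervals ]q (m - 1), q m] with q >= m - 1 leave no gap, which is
where the bound (m - 1)^2 + 1 comes from ([dilation_factor]).

Dilating only the variables in P, rather than all of them, makes phi and psi
congruent to the identity modulo P.  Hence P is the only prime that contains
phi(P), elements outside P stay outside P, and the whole argument takes place
at the single prime P.

Cohen-Macaulayness at P compares two numbers.  The Krull dimensions of S / I(m)
and S / I(t) at P agree because the two ideals are contained in the same primes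
([prime_symbolic_power]); call it d.  That the depth never exceeds the
dimension is proved by producing a chain of primes from a regular sequence
([regular_prime_chain]).  It remains to find a regular sequence of length d in
P for S / I(m).  One exists for S / I(t).  By prime avoidance it can be replaced
by one whose members lie in phi(P): at each step choose z in phi(P) outside all
associated primes of the successive quotients, put it in front and drop the
last member ([regular_in_subset]).  A sequence phi(c) that is regular on
S / I(t) comes from a sequence c that is regular on S / I(m), because psi
carries every relation back ([regular_retract]).

All of this is done with ideals of S that are compared up to multiplication by
elements outside P.  [local_cohen_macaulayP] and [cohen_macaulay_idealP] turn
the definition, which speaks of localizations of quotient rings, into that
language.  Noetherianity of S ([hilbert_basis]) comes from Dickson's lemma
applied to leading monomials. *)

Set Implicit Arguments.
Unset Strict Implicit.
Unset Printing Implicit Defensive.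

Import Order.TTheory GRing.Theory.
Local Open Scope ring_scope.
Local Open Scope quotient_scope.

(** * Ideals, associated primes and prime avoidance *)

Section Ideals.

Variable R : comNzRingType.
Implicit Types (K Q U T : R -> Prop) (a b f g s u v z : R).

Definition is_ideal K :=
  [/\ K 0, forall f g, K f -> K g -> K (f + g) & forall r f, K f -> K (r * f)].

Definition is_prime Q :=
  [/\ is_ideal Q, ~ Q 1 & forall f g, Q (f * g) -> Q f \/ Q g].

(** Stated as the maximum condition because that is how it is used: an ideal that
is maximal with some property is prime, or refutes a property by induction. *)
Definition noetherian := forall C : (R -> Prop) -> Prop,
  (exists K, C K) -> (forall K, C K -> is_ideal K) ->
  exists2 K, C K & forall K', C K' -> (forall f, K f -> K' f) ->
                              forall f, K' f -> K f.

Definition mult_set U := U 1 /\ forall s t, U s -> U t -> U (s * t).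

(** The ideal generated by [K] and [a]. *)
Definition ext K a f := exists g, K (f - g * a).

Definition colon K u f := K (f * u).

Lemma ideal0 K : is_ideal K -> K 0. Proof. by case. Qed.
Lemma idealD K f g : is_ideal K -> K f -> K g -> K (f + g).
Proof. by case=> _ + _; apply. Qed.
Lemma idealM K r f : is_ideal K -> K f -> K (r * f).
Proof. by case=> _ _; apply. Qed.
Lemma idealMl K r f : is_ideal K -> K f -> K (f * r).
Proof. by rewrite mulrC; exact: idealM. Qed.
Lemma idealN K f : is_ideal K -> K f -> K (- f).
Proof. by move=> iK; rewrite -mulN1r; exact: idealM. Qed.
Lemma idealB K f g : is_ideal K -> K f -> K g -> K (f - g).
Proof. by move=> iK Kf Kg; apply: idealD => //; exact: idealN. Qed.

Lemma ext_ideal K a : is_ideal K -> is_ideal (ext K a).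
Proof.
move=> iK; split.
- by exists 0; rewrite mul0r subr0; exact: ideal0.
- move=> f g [f' Hf] [g' Hg]; exists (f' + g').
  by rewrite (_ : _ - _ = f - f' * a + (g - g' * a)); [exact: idealD | ring].
- move=> r f [f' Hf]; exists (r * f').
  by rewrite (_ : _ - _ = r * (f - f' * a)); [exact: idealM | ring].
Qed.

Lemma sub_ext K a f : K f -> ext K a f.
Proof. by exists 0; rewrite mul0r subr0. Qed.

Lemma ext_gen K a : is_ideal K -> ext K a a.
Proof. by exists 1; rewrite mul1r subrr; exact: ideal0. Qed.

(** Adjoining elements in any order gives the same predicate, as an equality, so
that regular sequences can be permuted by rewriting. *)
Lemma extC K a b : ext (ext K a) b = ext (ext K b) a.
Proof.
suff H x y f : ext (ext K x) y f -> ext (ext K y) x f.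
  by apply/funext => f; apply/propext; split; exact: H.
by case=> g [h E]; exists h, g; rewrite addrAC.
Qed.

Lemma colon_ideal K u : is_ideal K -> is_ideal (colon K u).
Proof.
move=> iK; rewrite /colon; split; first by rewrite mul0r; exact: ideal0.
- by move=> f g Kf Kg; rewrite mulrDl; exact: idealD.
- by move=> r f Kf; rewrite -mulrA; exact: idealM.
Qed.

Lemma prime_ideal Q : is_prime Q -> is_ideal Q. Proof. by case. Qed.

Lemma prime_compl Q : is_prime Q -> mult_set (fun f => ~ Q f).
Proof. by case=> _ Q1 QM; split=> // s t Qs Qt /QM[]. Qed.

(** An ideal maximal among those that contain [K] and miss [U] is prime; such an
ideal exists by the maximum condition. *)
Lemma prime_avoiding K U : noetherian -> is_ideal K -> mult_set U ->
  (forall f, U f -> ~ K f) ->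
  exists Q, [/\ is_prime Q, forall f, K f -> Q f & forall f, U f -> ~ Q f].
Proof.
move=> noe iK [U1 UM] KU.
pose C Q := [/\ is_ideal Q, forall f, K f -> Q f & forall f, U f -> ~ Q f].
have [||Q [iQ KQ QU] maxQ] := noe C; [by exists K | by move=> ? [] |].
exists Q; split=> //; split=> //; first exact: QU.
move=> f g Qfg; apply: contrapT => /not_orP[Qf Qg].
have meet a : ~ Q a -> exists2 s, U s & ext Q a s.
  move=> Qa; apply: contrapT => H; apply: Qa.
  apply: (maxQ (ext Q a)); [split | exact: sub_ext | exact: ext_gen].
  - exact: ext_ideal.
  - by move=> ? /KQ; exact: sub_ext.
  - by move=> s Us Qs; apply: H; exists s.
have [s Us [s' Es]] := meet f Qf; have [t Ut [t' Et]] := meet g Qg.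
apply: (QU (s * t)); first exact: UM.
rewrite (_ : s * t = (s - s' * f) * t + (s' * f) * (t - t' * g) +
                     s' * t' * (f * g)); last by ring.
by apply: idealD => //; [apply: idealD => //; [exact: idealMl|]|]; exact: idealM.
Qed.

Definition assoc_prime K Q := is_prime Q /\ exists u, Q = colon K u.

(** If f g kills u but g does not, then the annihilator of g u contains that of
u, so by maximality f, which kills g u, already kills u. *)
Lemma colon_maximal_prime K u : is_ideal K -> ~ K u ->
  (forall v, ~ K v -> (forall f, colon K u f -> colon K v f) ->
             forall f, colon K v f -> colon K u f) ->
  is_prime (colon K u).
Proof.
move=> iK Ku umax; split; [exact: colon_ideal | by rewrite /colon mul1r |].
move=> f g Kfg; have [Kgu|Kgu] := pselect (K (g * u)); [by right | left].
apply: (umax (g * u)) => //; last by rewrite /colon mulrA.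
by move=> h; rewrite /colon mulrCA; exact: idealM.
Qed.

Lemma zero_divisor_assoc K a f : noetherian -> is_ideal K ->
  K (a * f) -> ~ K f -> exists2 Q, assoc_prime K Q & Q a.
Proof.
move=> noe iK Kaf Kf.
pose C Q := exists u, [/\ ~ K u, K (a * u) & Q = colon K u].
have [||_ [u [Ku Kau ->]] umax] := noe C.
- by exists (colon K f), f.
- by move=> _ [u [_ _ ->]]; exact: colon_ideal.
exists (colon K u) => //; split; last by exists u.
apply: colon_maximal_prime => // v Kv uv; apply: umax => //.
by exists v; split=> //; exact: uv.
Qed.

(** Let u and v have prime annihilators modulo [K].  If a nonzero multiple of v
is a multiple of u modulo [K], then both annihilators coincide, since a nonzero
multiple of an element with prime annihilator has the same annihilator.
Otherwise v generates the same module modulo [K] and modulo [ext K u]. *)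
Lemma assoc_ext K Q' u v : is_ideal K -> is_prime (colon K u) ->
  is_prime Q' -> Q' = colon K v ->
  Q' = colon K u \/ assoc_prime (ext K u) Q'.
Proof.
move=> iK pu pv Ev.
have [[r [Kr [g Kg]]]|H] := pselect (exists r, ~ K (r * v) /\ ext K u (r * v)).
  left; apply/funext => x; apply/propext.
  have Qr : ~ Q' r by rewrite Ev.
  have ug : ~ K (g * u).
    by move=> Kgu; apply: Kr; rewrite -(subrK (g * u) (r * v)); exact: idealD.
  have -> : Q' x <-> K (x * (r * v)).
    split; first by rewrite Ev /colon mulrCA; exact: idealM.
    rewrite mulrA => E; have : Q' (x * r) by rewrite Ev.
    by case: pv => _ _ /[apply] -[].
  have -> : colon K u x <-> K (x * (g * u)).
    split; first by rewrite /colon mulrCA; exact: idealM.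
    by rewrite mulrA => Kx; case: pu => _ _ /(_ x g Kx) [].
  have E : K (x * (r * v) - x * (g * u)) by rewrite -mulrBr; exact: idealM.
  split=> Kx; last by rewrite -(subrK (x * (g * u)) (x * (r * v))); exact: idealD.
  by rewrite -(subKr (x * (r * v)) (x * (g * u))); exact: idealB.
right; split=> //; exists v; rewrite Ev; apply/funext => x; apply/propext.
rewrite /colon; split; first exact: sub_ext.
by move=> E; apply: contrapT => Kx; apply: H; exists x.
Qed.

Lemma in_filter (p : pred (R -> Prop)) qs Q :
  List.In Q (filter p qs) <-> List.In Q qs /\ p Q.
Proof.
elim: qs => [|Q' qs IH] /=; first by split=> // -[].
case: ifP => pQ' /=; rewrite IH; split.
- by case=> [<-|[]]; split=> //; [left | right].
- by case=> -[<-|]; [left | right].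
- by case; split=> //; right.
- by case=> -[<-|//]; rewrite pQ'.
Qed.

(** Noetherian induction: a largest ideal [K] with infinitely many associated
primes would have one of the form [colon K u], and by [assoc_ext] all the others
would be associated to the strictly larger ideal [ext K u]. *)
Lemma assoc_primes_finite K : noetherian -> is_ideal K ->
  exists qs : seq (R -> Prop), forall Q, List.In Q qs <-> assoc_prime K Q.
Proof.
move=> noe iK.
suff [qs qsP] : exists qs : seq (R -> Prop),
    forall Q, assoc_prime K Q -> List.In Q qs.
  exists [seq Q <- qs | `[< assoc_prime K Q >]] => Q.
  by rewrite in_filter; split=> [[_ /asboolP]|/[dup]/qsP ? /asboolP].
apply: contrapT => nK.
pose C K := is_ideal K /\
  ~ exists qs : seq (R -> Prop), forall Q, assoc_prime K Q -> List.In Q qs.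
have [||{nK iK}K [iK nK] Kmax] := noe C; [by exists K | by move=> ? [] |].
have [[Q [pQ [u EQ]]]|noQ] := pselect (exists Q, assoc_prime K Q); last first.
  by apply: nK; exists [::] => Q Ql; case: noQ; exists Q.
have Ku : ~ K u by case: pQ; rewrite EQ /colon mul1r.
have [qs qsP] : exists qs : seq (R -> Prop),
    forall Q, assoc_prime (ext K u) Q -> List.In Q qs.
  apply: contrapT => nE; apply: Ku.
  apply: (Kmax (ext K u)); [|exact: sub_ext | exact: ext_gen].
  by split=> //; exact: ext_ideal.
apply: nK; exists (Q :: qs) => Q' [pQ' [v Ev]].
rewrite EQ in pQ.
have [->|/qsP] := assoc_ext iK pQ pQ' Ev; [by left | by right].
Qed.

(** [T] is not assumed to be an ideal because it will be the image of one under a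
ring endomorphism, which is closed under sums and products only. *)
Lemma prime_avoidance T (qs : seq (R -> Prop)) :
  (forall f g, T f -> T g -> T (f + g)) ->
  (forall f g, T f -> T g -> T (f * g)) -> (exists z, T z) ->
  (forall Q, List.In Q qs -> is_prime Q /\ exists2 z, T z & ~ Q z) ->
  exists2 z, T z & forall Q, List.In Q qs -> ~ Q z.
Proof.
move=> TD TM T0; elim: qs => [_|Q qs IH qsP]; first by case: T0 => z; exists z.
have [|z Tz zqs] := IH; first by move=> Q' Q'qs; apply: qsP; right.
have [[iQ _ QM] [t0 Tt0 Qt0]] : is_prime Q /\ exists2 z, T z & ~ Q z.
  by apply: qsP; left.
have [Qz|Qz] := pselect (Q z); last by exists z => // Q' [<-|/zqs].
(* z + t will avoid all the primes: a Q' of the second kind meets T only inside Q. *)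
have [t [Tt Qt tP]] : exists t, [/\ T t, ~ Q t & forall Q', List.In Q' qs ->
    Q' t \/ forall f, T f -> Q' f -> Q f].
  (* t is a product of elements of T outside Q, one in each Q' that allows it. *)
  have {IH zqs} : forall Q, List.In Q qs -> is_ideal Q.
    by move=> Q' Q'qs; case: (qsP Q'); [right | case].
  elim: qs {qsP} => [|Q' qs IH] iqs; first by exists t0.
  have [|t [Tt Qt tP]] := IH; first by move=> Q'' Hq; apply: iqs; right.
  have [H|] := pselect (forall f, T f -> Q' f -> Q f).
    by exists t; split=> // Q'' [<-|/tP//]; right.
  move=> /existsNP[f /not_implyP[Tf /not_implyP[Q'f Qf]]].
  exists (f * t); split; [exact: TM | by case/QM |].
  move=> Q'' [<-|Hq]; first by left; apply: idealMl => //; apply: iqs; left.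
  have [|] := tP _ Hq; [left | by right].
  by apply: idealM => //; apply: iqs; right.
exists (z + t); first exact: TD.
have Qzt : ~ Q (z + t).
  by move=> H; apply: Qt; rewrite -(addKr z t); apply: idealD => //; exact: idealN.
move=> Q' [<-//|Q'qs] Q'zt.
have [Q't|TQ] := tP _ Q'qs; last by apply: Qzt; apply: TQ => //; exact: TD.
apply: (zqs Q') => //; rewrite -(addrK t z).
by apply: idealB => //; case: (qsP Q'); [right | case].
Qed.

End Ideals.

(** * Regular sequences and chains of primes at a prime *)

Section RegularSequences.

Variable R : comNzRingType.
Implicit Types (K Q T P : R -> Prop) (a b f g s u v z : R) (l : seq R).

(** The ideal of those f whose image lies in the extension of [K] to the
localization at [U]. *)
Definition sat (U : R -> Prop) K f := exists2 s, U s & K (s * f).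

Definition nonzerodiv U K a := forall f, sat U K (f * a) -> sat U K f.

(** Regularity in the localization at [U] of the quotient by [K]; the ideals are
kept unsaturated, so that they stay images of explicit generators, and the
saturation occurs only in [nonzerodiv]. *)
Fixpoint regular U K l : Prop :=
  if l is a :: l' then nonzerodiv U K a /\ regular U (ext K a) l' else True.

Fixpoint all_nonzerodiv U K l z : Prop :=
  if l is a :: l' then nonzerodiv U K z /\ all_nonzerodiv U (ext K a) l' z
  else True.

Section Saturation.

Variables (U : R -> Prop) (mU : mult_set U).

Lemma sub_sat K f : K f -> sat U K f.
Proof. by case: mU => U1 _ Kf; exists 1 => //; rewrite mul1r. Qed.

Lemma sat_sub K K' f : (forall g, K g -> sat U K' g) -> sat U K f -> sat U K' f.
Proof.
have [_ UM] := mU; move=> KK' [s Us /KK' [t Ut Ktsf]].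
by exists (t * s); [exact: UM | rewrite -mulrA].
Qed.

Lemma satK K f : sat U (sat U K) f -> sat U K f. Proof. exact: sat_sub. Qed.

Lemma sat_cancel K s f : U s -> sat U K (s * f) -> sat U K f.
Proof. by move=> Us H; apply: satK; exists s. Qed.

Lemma sat_ideal K : is_ideal K -> is_ideal (sat U K).
Proof.
have [U1 UM] := mU; move=> iK; split.
- by apply: sub_sat; exact: ideal0.
- move=> f g [s Us Ksf] [t Ut Ktg]; exists (s * t); first exact: UM.
  rewrite (_ : _ * _ = t * (s * f) + s * (t * g)); last by ring.
  by apply: idealD => //; exact: idealM.
- by move=> r f [s Us Ksf]; exists s => //; rewrite mulrCA; exact: idealM.
Qed.

(** The elementary fact behind permuting regular sequences: from a f = z v, first
v = a w because z is regular modulo a, and then f = z w because a is regular. *)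
Lemma nonzerodiv_swap K a z : is_ideal K -> nonzerodiv U K a ->
  nonzerodiv U (ext K a) z -> nonzerodiv U K z ->  nonzerodiv U (ext K z) a.
Proof.
have [_ UM] := mU; move=> iK Ka Kaz Kz f [s Us [v Kv]].
have [s' Us' [w Kw]] : sat U (ext K a) v.
  apply: Kaz; apply: sub_sat; exists (s * f).
  rewrite (_ : _ - _ = - (s * (f * a) - v * z)); last by ring.
  exact: idealN.
have [t Ut Kt] : sat U K (s' * s * f - w * z).
  apply: Ka; apply: sub_sat.
  rewrite (_ : _ * _ = s' * (s * (f * a) - v * z) + z * (s' * v - w * a)).
    by apply: idealD => //; exact: idealM.
  by ring.
exists (t * (s' * s)); first by do 2!apply: (UM) => //.
by exists (t * w); rewrite (_ : _ - _ = t * (s' * s * f - w * z)) //; ring.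
Qed.

(** If z is regular modulo every initial segment of the sequence, moving it to the
front, at the expense of the last member, keeps regularity: apply
[nonzerodiv_swap] to each member in turn. *)
Lemma regular_belast K a l z : is_ideal K -> regular U K (a :: l) ->
  all_nonzerodiv U K (a :: l) z -> regular U (ext K z) (belast a l).
Proof.
elim: l K a => [//|b l IH] K a iK [Ka Kl] [Kz Kzl]; split.
  by apply: nonzerodiv_swap => //; case: Kzl.
by rewrite extC; apply: IH => //; exact: ext_ideal.
Qed.

End Saturation.

Section AtPrime.

Variables (noe : noetherian R) (P : R -> Prop) (pP : is_prime P).
Let U f := ~ P f.
Let mU : mult_set U := prime_compl pP.

(** The primes to avoid are the associated primes of the successive quotients.
None of them contains [P], for each quotient has a regular element in [P]: the
next member of the sequence. *)
Lemma all_nonzerodiv_avoid K l : is_ideal K -> regular U K l ->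
  (forall a, a \in l -> P a) ->
  exists qs : seq (R -> Prop),
    (forall Q, List.In Q qs -> is_prime Q /\ exists2 a, P a & ~ Q a) /\
    forall z, (forall Q, List.In Q qs -> ~ Q z) -> all_nonzerodiv U K l z.
Proof.
elim: l K => [|a l IH] K iK /=; first by exists [::].
case=> Ka Kl Pl.
have [|||qs [qsP qsz]] := IH (ext K a) => //; first exact: ext_ideal.
  by move=> b bl; apply: Pl; rewrite in_cons bl orbT.
have isK := sat_ideal mU iK.
have [qs' qs'P] := assoc_primes_finite noe isK.
exists (qs' ++ qs); split.
  move=> Q /List.in_app_iff[/qs'P[pQ [u EQ]]|/qsP//].
  split=> //; exists a; first by apply: Pl; rewrite mem_head.
  rewrite EQ => /= Kau; case: pQ => _ + _; rewrite EQ; apply.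
  by rewrite /colon mul1r; apply: Ka; rewrite mulrC.
move=> z zqs; split; last first.
  by apply: qsz => Q Qqs; apply: zqs; apply/List.in_app_iff; right.
move=> f Kfz; apply: contrapT => Kf.
rewrite mulrC in Kfz.
have [Q /qs'P Qqs Qz] := zero_divisor_assoc noe isK Kfz Kf.
by apply: (zqs Q) => //; apply/List.in_app_iff; left.
Qed.

(** The depth can be computed with elements of [T] alone.  The primes listed by
[all_nonzerodiv_avoid] do not contain [P], hence not [T] either, so some z in
[T] avoids them; put z in front by [regular_belast] and continue modulo z. *)
Lemma regular_in_subset T K l :
  (forall f g, T f -> T g -> T (f + g)) ->
  (forall f g, T f -> T g -> T (f * g)) -> (exists z, T z) ->
  (forall Q, is_prime Q -> (forall f, T f -> Q f) -> forall f, P f -> Q f) ->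
  is_ideal K -> regular U K l -> (forall a, a \in l -> P a) ->
  exists l', [/\ size l' = size l, forall a, a \in l' -> T a & regular U K l'].
Proof.
move=> TD TM T0 TP; have [d] := ubnP (size l); elim: d => // d IH in l K *.
case: l => [|a l] ld iK Kl Pl; first by exists [::].
have [qs [qsP qsz]] := all_nonzerodiv_avoid iK Kl Pl.
(* z becomes the first member; the last old one is dropped. *)
have [|z Tz zqs] := prime_avoidance (qs := qs) TD TM T0.
  move=> Q /qsP[pQ [b Pb Qb]]; split=> //; apply: contrapT => H; apply: Qb.
  by apply: TP Pb => // f Tf; apply: contrapT => Qf; apply: H; exists f.
have Kz := qsz z zqs.
have [||||l' [sl' Tl' Kl']] := IH (belast a l) (ext K z).
- by rewrite size_belast.
- exact: ext_ideal.
- exact: regular_belast.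
- by move=> b /mem_belast; exact: Pl.
exists (z :: l'); split; first by rewrite /= sl' size_belast.
- by move=> b; rewrite in_cons => /predU1P[->|/Tl'].
- by split=> //; case: Kz.
Qed.

Definition prime_chain_between K P' (e : nat) := exists c : nat -> R -> Prop,
  (forall i, (i <= e)%N -> [/\ is_prime (c i), forall f, K f -> c i f &
                               forall f, c i f -> P' f]) /\
  forall i, (i < e)%N -> (forall f, c i f -> c i.+1 f) /\
                         exists2 f, c i.+1 f & ~ c i f.

(** Depth is at most dimension.  Let the chain for the tail of the sequence start
at the prime Q1.  Some prime Q0 contains [K] and misses all s a^i with s outside
Q1; thus it lies in Q1 and omits a.  It exists because s a^i in [K] would put s
in the saturation of [K], hence in Q1. *)
Lemma regular_prime_chain K l : is_ideal K -> (forall f, K f -> P f) ->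
  (forall a, a \in l -> P a) -> regular U K l -> prime_chain_between K P (size l).
Proof.
elim: l K => [|a l IH] K iK KP Pl /=.
  by move=> _; exists (fun=> P); split.
case=> Ka Kl; have Pa : P a by apply: Pl; rewrite mem_head.
have KaP f : ext K a f -> P f.
  case=> g /KP; rewrite -{2}(subrK (g * a) f).
  by move/(idealD (prime_ideal pP)); apply; apply: idealM => //; exact: prime_ideal.
have [||b bl||c [cP cS]] := IH (ext K a) => //; first exact: ext_ideal.
  by apply: Pl; rewrite in_cons bl orbT.
have [pc0 Kc0 c0P] := cP 0%N isT.
(* The new bottom prime has to lie in c 0 and to omit a. *)
pose V v := exists s i, ~ c 0%N s /\ v = s * a ^+ i.
have [|v|Q [pQ KQ QV]] := @prime_avoiding R K V noe iK.
- split; first by exists 1, 0%N; rewrite mulr1; split=> //; case: pc0.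
  move=> _ _ [s [i [cs ->]]] [t [j [ct ->]]].
  exists (s * t), (i + j)%N; split; last by rewrite exprD; ring.
  by case: pc0 => _ _ H /H[].
- move=> [s [i [cs ->]]] Ks; apply: cs.
  have : sat U K s.
    have := sub_sat mU Ks.
    elim: i {Ks} => [|i IHi]; first by rewrite mulr1.
    by rewrite exprSr mulrA => /Ka.
  case=> t Ut /(sub_ext a)/Kc0; case: pc0 => _ _ /[apply] -[]//.
  by move/c0P.
have Qc0 f : Q f -> c 0%N f.
  move=> Qf; apply: contrapT => cf; apply: (QV f) => //.
  by exists f, 0%N; rewrite mulr1.
have Qa : ~ Q a.
  apply: QV; exists 1, 1%N; rewrite mul1r; split=> //.
  by case: pc0.
exists (fun i => if i is j.+1 then c j else Q); split.
  case=> [_|i /cP[pc Kc cP']]; first by split=> // f /Qc0/c0P.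
  by split=> // f /(sub_ext a)/Kc.
case=> [_|i /cS//]; split=> //; exists a => //.
by apply: Kc0; exact: ext_gen.
Qed.

Lemma prime_chain_between_leq K P' e e' : (e' <= e)%N ->
  prime_chain_between K P' e -> prime_chain_between K P' e'.
Proof.
move=> ee' [c [cP cS]]; exists c; split=> i Hi; [apply: cP | apply: cS].
  exact: leq_trans Hi ee'.
exact: leq_trans Hi ee'.
Qed.

End AtPrime.

(** Regularity descends along a split map: a relation among the members of [l]
modulo [K] is mapped by [phi] to one modulo [K'], can be simplified there, and
is brought back by [psi], which is linear along [phi].  The two compatibility
hypotheses between [K] and [K'] persist when a and phi(a) are adjoined. *)
Lemma regular_retract U (phi psi : {additive R -> R}) K K' l :
  mult_set U -> is_ideal K' -> is_ideal K ->
  (forall f g, phi (f * g) = phi f * phi g) ->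
  (forall f g, psi (phi f * g) = f * psi g) ->
  (forall s, U s -> U (phi s)) -> (forall s, U s -> U (psi s)) ->
  (forall f, K f -> sat U K' (phi f)) -> (forall f, K' f -> sat U K (psi f)) ->
  regular U K' (map phi l) -> regular U K l.
Proof.
move=> mU + + phiM psiM Uphi Upsi; elim: l K K' => //= a l IH K K' iK' iK KK' K'K.
case=> K'a K'l; split.
  move=> f [s Us /KK'[t Ut]]; rewrite !phiM => E.
  have [v Uv Kv] : sat U K' (phi f).
    apply: K'a; exists (t * phi s); last by rewrite -mulrA.
    by case: mU => _; apply => //; exact: Uphi.
  have [w Uw Kw] := K'K _ Kv; apply: (sat_cancel mU (Upsi v Uv)).
  by exists w => //; rewrite (mulrC _ f) -psiM (mulrC (phi f)).
apply: (IH _ (ext K' (phi a))) => //; try exact: ext_ideal.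
  move=> f [g /KK'[s Us]]; rewrite raddfB phiM mulrBr => Ks.
  by exists s => //; exists (s * phi g); rewrite -mulrA.
move=> f [g /K'K[s Us]]; rewrite raddfB (mulrC g) psiM mulrBr => Ks.
by exists s => //; exists (s * psi g); rewrite -mulrA (mulrC _ a).
Qed.

End RegularSequences.

(** * Ideals, primes and regular sequences as boolean and as Prop predicates *)

Section Packing.

Variable R : comNzRingType.
Implicit Types K Q : R -> Prop.

Definition predb K : {pred R} := fun f => `[< K f >].

Lemma predb_idealr_closed K : is_ideal K -> ~ K 1 -> idealr_closed (predb K).
Proof.
move=> iK K1; split; first by apply/asboolP; exact: ideal0.
  by apply/asboolP.
move=> a u v /asboolP Ku /asboolP Kv; apply/asboolP.
by apply: idealD => //; exact: idealM.
Qed.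

Definition idealr_of K (iK : is_ideal K) (K1 : ~ K 1) : idealr R :=
  HB.pack (predb K) (isIdealr.Build R (predb K) (predb_idealr_closed iK K1)).

Lemma predb_prime_closed Q : is_prime Q -> prime_idealr_closed (predb Q).
Proof.
case=> _ _ QM u v /asboolP/QM[] H; apply/orP; [left | right]; exact/asboolP.
Qed.

Definition prime_idealr_of Q (pQ : is_prime Q) : prime_idealr R :=
  HB.pack (predb Q) (isIdealr.Build R (predb Q)
    (predb_idealr_closed (prime_ideal pQ) (let: And3 _ Q1 _ := pQ in Q1)))
    (isPrimeIdealrClosed.Build R (predb Q) (predb_prime_closed pQ)).

Lemma in_idealr_of K (iK : is_ideal K) (K1 : ~ K 1) f :
  (f \in idealr_of iK K1) = `[< K f >].
Proof. by []. Qed.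

Lemma in_prime_idealr_of Q (pQ : is_prime Q) f :
  (f \in prime_idealr_of pQ) = `[< Q f >].
Proof. by []. Qed.

Lemma idealr_ideal (I : idealr R) : is_ideal (fun f => f \in I).
Proof.
split; [exact: idealr0 | by move=> f g; exact: rpredD | by move=> r f; exact: idealMr].
Qed.

Lemma idealr_proper (I : idealr R) : ~ 1 \in I.
Proof. by rewrite idealr1. Qed.

Lemma prime_idealr_prime (I : prime_idealr R) : is_prime (fun f => f \in I).
Proof.
split; [exact: idealr_ideal | exact: idealr_proper |].
by move=> f g; rewrite prime_idealrM => /orP.
Qed.

Definition is_maximal Q := [/\ is_ideal Q, ~ Q 1 &
  forall K, is_ideal K -> ~ K 1 -> (forall f, Q f -> K f) ->
            forall f, K f -> Q f].

Lemma maximal_idealP (I : idealr R) :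
  maximal_ideal I <-> is_maximal (fun f => f \in I).
Proof.
split=> [H|[_ _ H] J IJ].
  split; [exact: idealr_ideal | exact: idealr_proper |].
  move=> K iK K1 IK f Kf; apply: (H (idealr_of iK K1)); last first.
    by rewrite in_idealr_of; apply/asboolP.
  by move=> g /IK Kg; rewrite in_idealr_of; apply/asboolP.
by apply: H => //; [exact: idealr_ideal | exact: idealr_proper].
Qed.

(** The zero ideal and the full predicate as bounds express chains of a ring in
the form used for chains between an ideal and a prime. *)
Lemma prime_chainP e : prime_chain R e <->
  prime_chain_between (eq 0) (fun _ : R => True) e.
Proof.
split=> [[c cP]|[c [cP cS]]].
  exists (fun i f => f \in c (inord i)); split.
    move=> i ie; split=> //; first exact: prime_idealr_prime.
    by move=> _ <-; exact: idealr0.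
  move=> i ie; have [|sub nsub] := cP (inord i) (inord i.+1).
    by rewrite !inordK// ltnW.
  split; first exact: sub.
  apply: contrapT => H; apply: nsub => f cf; apply: contrapT => ncf.
  by apply: H; exists f.
have pc (i : 'I_e.+1) : is_prime (c i) by case: (cP i) => //; rewrite -ltnS.
exists (fun i => prime_idealr_of (pc i)) => i j ij.
have cmono a b : (a <= b)%N -> (b <= e)%N -> forall f, c a f -> c b f.
  elim: b => [|b IH]; first by rewrite leqn0 => /eqP->.
  rewrite leq_eqVlt => /predU1P[->//|ab] be f caf.
  by have [H _] := cS b be; apply: H; apply: IH => //; exact: ltnW.
split=> [f|].
  rewrite !in_prime_idealr_of => /asboolP cf; apply/asboolP.
  by apply: cmono cf; [exact: ltnW | rewrite -ltnS].
have je : (j <= e)%N by rewrite -ltnS.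
have [_ [f cf ncf]] := cS i (leq_trans ij je).
move=> /(_ f); rewrite !in_prime_idealr_of => H; apply: ncf; apply/asboolP.
by apply: H; apply/asboolP; exact: cmono cf.
Qed.

Definition gen_seq K (l : seq R) := foldl (@ext R) K l.

Lemma gen_seq_rcons K l a : gen_seq K (rcons l a) = ext (gen_seq K l) a.
Proof. by rewrite /gen_seq -cats1 foldl_cat. Qed.

Lemma gen_seq_ideal K l : is_ideal K -> is_ideal (gen_seq K l).
Proof. by elim: l K => //= a l IH K iK; apply: IH; exact: ext_ideal. Qed.

Lemma zero_ideal : is_ideal (eq (0 : R)).
Proof.
by split=> [//|_ _ <- <-|r _ <-]; rewrite ?addr0 ?mulr0.
Qed.

Lemma ideal_gen_ideal A : is_ideal (fun f => f \in @ideal_gen R A).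
Proof.
split.
- by apply/asboolP; exists [::] => //; rewrite big_nil.
- move=> f g /asboolP[s sA ->] /asboolP[t tA ->]; apply/asboolP.
  exists (s ++ t); last by rewrite big_cat.
  by move=> x; rewrite mem_cat => /orP[/sA|/tA].
- move=> r f /asboolP[s sA ->]; apply/asboolP.
  exists [seq (r * x.1, x.2) | x <- s]; first by move=> _ /mapP[x /sA xA ->].
  by rewrite big_map big_distrr; apply: eq_bigr => x _ /=; rewrite mulrA.
Qed.

Lemma ideal_gen_sub (A : R -> Prop) f : A f -> f \in @ideal_gen R A.
Proof.
move=> Af; apply/asboolP; exists [:: (1, f)]; last by rewrite big_seq1 mul1r.
by move=> x; rewrite inE => /eqP->.
Qed.

Lemma ideal_gen_min (A : R -> Prop) K : is_ideal K -> (forall f, A f -> K f) ->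
  forall f, f \in @ideal_gen R A -> K f.
Proof.
move=> iK AK f /asboolP[s sA ->]; rewrite big_seq.
elim/big_ind: _ => [|g h|x /sA/AK]; [exact: ideal0 | exact: idealD |].
exact: idealM.
Qed.

Lemma gen_seqE l f : gen_seq (eq 0) l f <-> f \in ideal_gen (fun a => a \in l).
Proof.
split.
  elim/last_ind: l f => [|l a IH] f /=; first
    by move=> <-; case: (ideal_gen_ideal (fun b => b \in [::])).
  rewrite gen_seq_rcons => -[g /IH H]; rewrite -(subrK (g * a) f).
  have [_ iD iM] := ideal_gen_ideal (fun b => b \in rcons l a).
  apply: iD.
    apply: (ideal_gen_min (ideal_gen_ideal _) _ H) => b bl; apply: ideal_gen_sub.
    by rewrite mem_rcons in_cons bl orbT.
  by apply: iM; apply: ideal_gen_sub; rewrite mem_rcons mem_head.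
apply: ideal_gen_min; first by apply: gen_seq_ideal; exact: zero_ideal.
elim/last_ind: l => // l a IH b; rewrite mem_rcons in_cons gen_seq_rcons.
case/predU1P=> [->|/IH]; last exact: sub_ext.
by apply: ext_gen; apply: gen_seq_ideal; exact: zero_ideal.
Qed.

Lemma sat1 K f : sat (eq 1) K f <-> K f.
Proof.
by split=> [[_ <-]|]; [rewrite mul1r | exists 1 => //; rewrite mul1r].
Qed.

Lemma regular_nth U K l : regular U K l <-> forall i, (i < size l)%N ->
  nonzerodiv U (gen_seq K (take i l)) l`_i.
Proof.
elim: l K => [|a l IH] K //=; rewrite IH; split.
  by case=> Ka Kl [|i] //= /Kl.
by move=> H; split=> [|i il]; [exact: (H 0%N) | exact: (H i.+1)].
Qed.

Lemma regular_sequenceP l : regular_sequence l <->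
  regular (eq (1 : R)) (eq 0) l /\ ~ gen_seq (eq 0) l 1.
Proof.
rewrite /regular_sequence regular_nth gen_seqE.
split=> -[H H1]; (split; last exact/negP) => i il.
  by move=> f; rewrite !sat1 !gen_seqE; exact: H.
by move=> f; have := H i il f; rewrite !sat1 !gen_seqE.
Qed.

End Packing.

(** * Cohen-Macaulayness of a localization, read upstairs *)

(** The properties of the canonical map from [R] to the localization of [R / J]
at the image of [P] on which everything below relies. *)
Record is_localization (R L : comNzRingType) (pi : {rmorphism R -> L})
    (J P : R -> Prop) : Prop := IsLocalization {
  loc_frac_of : forall x, exists r s, ~ P s /\ pi s * x = pi r;
  loc_unit : forall s, ~ P s -> exists y, pi s * y = 1;
  loc_ker : forall r, pi r = 0 <-> sat (fun s => ~ P s) J r }.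

Section Localization.

Variables (R L : comNzRingType) (pi : {rmorphism R -> L}) (J P : R -> Prop).
Hypotheses (iJ : is_ideal J) (pP : is_prime P) (JP : forall f, J f -> P f).
Hypothesis locL : is_localization pi J P.
Let U s := ~ P s.
Let mU : mult_set U := prime_compl pP.
Implicit Types (K Q : R -> Prop) (KL QL : L -> Prop) (x y a : L) (f g r s : R).

(** [K] need not be the full preimage of [KL], only a representative of it up to
multiplication by elements outside [P]. *)
Definition contracts KL K := is_ideal KL /\ forall f, KL (pi f) <-> sat U K f.

Lemma contracts0 : contracts (eq 0) J.
Proof.
by split=> [|f]; [exact: zero_ideal | rewrite -(loc_ker locL); split=> ->].
Qed.

Lemma unit_cancel KL s x : is_ideal KL -> U s -> KL (pi s * x) -> KL x.
Proof.
move=> iKL /(loc_unit locL)[y sy] /(idealM y iKL).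
by rewrite mulrA (mulrC y) sy mul1r.
Qed.

(** [a] and the image of [r] generate the same ideal, as they differ by a unit. *)
Lemma contracts_ext KL K a r s : contracts KL K -> U s -> pi s * a = pi r ->
  contracts (ext KL a) (ext K r).
Proof.
move=> [iKL KLK] Us sa; have iE := ext_ideal a iKL; split=> // f; split.
  case=> y Ky; have [g [t [Ut ty]]] := loc_frac_of locL y.
  have : KL (pi (t * s * f - g * r)).
    rewrite rmorphB !rmorphM -ty -sa.
    rewrite (_ : _ - _ = pi t * pi s * (pi f - y * a)); last by ring.
    exact: idealM.
  case/KLK => u Uu Ku; exists (u * (t * s)).
    by case: mU => _ UM; apply: (UM) => //; exact: UM.
  by exists (u * g); rewrite -!mulrA -mulrBr !mulrA in Ku *.
case=> u Uu [g Kg]; apply: (unit_cancel iE Uu); exists (pi g * pi s).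
rewrite -mulrA sa -!rmorphM -rmorphB; apply/KLK; exact: sub_sat.
Qed.

Lemma contracts_nonzerodiv KL K a r s : contracts KL K -> U s ->
  pi s * a = pi r -> nonzerodiv (eq 1) KL a <-> nonzerodiv U K r.
Proof.
move=> [iKL KLK] Us sa; split=> H.
  move=> f /KLK; rewrite rmorphM -sa mulrCA => /(unit_cancel iKL Us).
  by move/sat1/H/sat1/KLK.
move=> x; rewrite !sat1 => Kxa; have [f [t [Ut tx]]] := loc_frac_of locL x.
apply: (unit_cancel iKL Ut); rewrite tx; apply/KLK/H/KLK.
rewrite rmorphM -tx -sa (_ : _ * _ = pi t * pi s * (x * a)); last by ring.
exact: idealM.
Qed.

(** Members of a regular sequence downstairs are multiplied by units so that they
come from [R]; as nonunits they then come from [P]. *)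
Lemma regular_contract KL K l : contracts KL K ->
  (forall a, a \in l -> ~ exists y, a * y = 1) -> regular (eq 1) KL l ->
  exists l', [/\ size l' = size l, forall r, r \in l' -> P r & regular U K l'].
Proof.
elim: l KL K => [|a l IH] KL K c nl /=; first by exists [::].
have [r [s [Us sa]]] := loc_frac_of locL a.
case=> /(contracts_nonzerodiv c Us sa) Kr.
move=> Kl; have [b bl|l' [<- l'P Kl']] := IH _ _ (contracts_ext c Us sa) _ Kl.
- by apply: nl; rewrite in_cons bl orbT.
exists (r :: l'); split=> // b; rewrite in_cons => /predU1P[->|/l'P//].
apply: contrapT => /(loc_unit locL)[y]; rewrite -sa => say.
apply: (nl a); first exact: mem_head.
by exists (pi s * y); rewrite -say mulrA (mulrC a).
Qed.

Lemma regular_expand KL K l : contracts KL K -> regular U K l ->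
  regular (eq 1) KL (map pi l).
Proof.
elim: l KL K => //= r l IH KL K c [Kr Kl].
have U1 : U 1 by case: mU.
have E : pi 1 * pi r = pi r by rewrite rmorph1 mul1r.
split; first exact/(contracts_nonzerodiv c U1 E).
exact: IH (contracts_ext c U1 E) Kl.
Qed.

Definition expand Q x := exists r s, [/\ U s, pi s * x = pi r & Q r].

Lemma expand_ideal Q : is_ideal Q -> is_ideal (expand Q).
Proof.
have [U1 UM] := mU; move=> iQ; split.
- by exists 0, 1; rewrite mulr0 rmorph0; split=> //; exact: ideal0.
- move=> x y [f [s [Us sx Qf]]] [g [t [Ut ty Qg]]].
  exists (t * f + s * g), (s * t); split; first exact: UM.
    by rewrite rmorphD !rmorphM -sx -ty; ring.
  by apply: idealD => //; exact: idealM.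
- move=> y x [f [s [Us sx Qf]]]; have [g [t [Ut ty]]] := loc_frac_of locL y.
  exists (g * f), (t * s); split; first exact: UM.
    by rewrite !rmorphM -sx -ty; ring.
  exact: idealM.
Qed.

Lemma expandE Q f : is_prime Q -> (forall g, J g -> Q g) ->
  (forall g, Q g -> P g) -> expand Q (pi f) <-> Q f.
Proof.
have [U1 UM] := mU; move=> [iQ Q1 QM] JQ QP; split.
  case=> r [s [Us]]; rewrite -rmorphM => /eqP; rewrite -subr_eq0 -rmorphB.
  move=> /eqP/(loc_ker locL)[t Ut /JQ Qt] Qr.
  have : Q (t * s * f).
    rewrite (_ : _ * f = t * (s * f - r) + t * r); last by ring.
    by apply: idealD => //; exact: idealM.
  by case/QM => // /QP; have := UM _ _ Ut Us.
by move=> Qf; exists f, 1; rewrite rmorph1 mul1r.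
Qed.

Lemma expand_prime Q : is_prime Q -> (forall g, J g -> Q g) ->
  (forall g, Q g -> P g) -> is_prime (expand Q).
Proof.
have [U1 UM] := mU; move=> pQ JQ QP; have [iQ Q1 QM] := pQ.
have iE := expand_ideal iQ; split=> //.
  by rewrite -(rmorph1 pi) (expandE _ pQ).
move=> x y; have [f [s [Us sx]]] := loc_frac_of locL x.
have [g [t [Ut ty]]] := loc_frac_of locL y.
move=> /(idealM (pi s * pi t) iE).
rewrite (_ : _ * _ = (pi s * x) * (pi t * y)); last by ring.
rewrite sx ty -rmorphM (expandE _ pQ)// => /QM[] H; [left | right].
  by apply: (unit_cancel iE Us); rewrite sx (expandE _ pQ).
by apply: (unit_cancel iE Ut); rewrite ty (expandE _ pQ).
Qed.

Lemma contract_prime QL : is_prime QL ->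
  [/\ is_prime (fun f => QL (pi f)), forall f, J f -> QL (pi f) &
      forall f, QL (pi f) -> P f].
Proof.
move=> [iQ Q1 QM]; split.
- split; [split| |].
  + by rewrite rmorph0; exact: ideal0.
  + by move=> f g Qf Qg; rewrite rmorphD; exact: idealD.
  + by move=> r f Qf; rewrite rmorphM; exact: idealM.
  + by rewrite rmorph1.
  + by move=> f g; rewrite rmorphM; exact: QM.
- by move=> f /(sub_sat mU)/(loc_ker locL)->; exact: ideal0.
- move=> f Qf; apply: contrapT => /(loc_unit locL)[y fy]; apply: Q1.
  by rewrite -fy; exact: idealMl.
Qed.

(** Contraction is strictly monotone on primes because every element of [L] is, up
to a unit, the image of an element of [R]. *)
Lemma localization_prime_chain e :
  prime_chain_between (eq 0) (fun _ : L => True) e <-> prime_chain_between J P e.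
Proof.
split=> -[c [cP cS]].
  exists (fun i f => c i (pi f)); split; first by move=> i /cP[/contract_prime].
  move=> i ie; have [sub [x cx ncx]] := cS i ie; split; first by move=> f /sub.
  have [f [s [Us sx]]] := loc_frac_of locL x.
  have [[ic _ _] _ _] := cP _ ie; have [[ic' _ _] _ _] := cP _ (ltnW ie).
  exists f; rewrite -sx; first exact: idealM.
  by move/(unit_cancel ic' Us).
exists (fun i => expand (c i)); split.
  move=> i /cP[pc Jc cP']; split=> //; first exact: expand_prime.
  by move=> _ <-; apply: ideal0; apply: expand_ideal; case: pc.
move=> i ie; have [sub [f cf ncf]] := cS i ie.
have [pc Jc Pc] := cP _ ie; have [pc' Jc' Pc'] := cP _ (ltnW ie).
split; first by move=> x [r [s [Us sx /sub cr]]]; exists r, s.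
by exists (pi f); rewrite expandE.
Qed.

Lemma expand_maximal : is_maximal (expand P).
Proof.
have [iE E1 _] := expand_prime pP JP (fun=> id); split=> // K iK K1 PK x Kx.
have [f [s [Us sx]]] := loc_frac_of locL x.
exists f, s; split=> //; apply: contrapT => /(loc_unit locL)[y fy]; apply: K1.
by rewrite -fy -sx; apply: idealMl => //; exact: idealM.
Qed.

Lemma proper_sub_expand KL : is_ideal KL -> ~ KL 1 ->
  forall x, KL x -> expand P x.
Proof.
move=> iK K1 x Kx; have [f [s [Us sx]]] := loc_frac_of locL x.
exists f, s; split=> //; apply: contrapT => /(loc_unit locL)[y fy]; apply: K1.
by rewrite -fy -sx; apply: idealMl => //; exact: idealM.
Qed.

Hypothesis noe : noetherian R.

(** The unique maximal ideal, the dimension and the depth of [L], all expressed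
with ideals and elements of [R].  The upper bound on the depth in the
definition on the left comes from [regular_prime_chain]. *)
Lemma local_cohen_macaulayP : local_cohen_macaulay L <-> exists d,
  [/\ prime_chain_between J P d, ~ prime_chain_between J P d.+1 &
      exists l, [/\ size l = d, forall r, r \in l -> P r & regular U J l]].
Proof.
split.
  case=> M [[maxM _] [d [[]]]]; rewrite !prime_chainP !localization_prime_chain.
  move=> cd ncd [[l [/regular_sequenceP[regl _] lM sl]] _].
  exists d; split=> //.
  have [|l' [sl' l'P l'reg]] := regular_contract contracts0 _ regl.
    move=> a /lM aM [y ay]; apply: (idealr_proper (I := M)).
    by rewrite -ay; apply: (idealMl y (idealr_ideal M)).
  by exists l'; rewrite sl' sl.
case=> d [cd ncd [l [sl lP regl]]].
have [iE E1 Emax] := expand_maximal.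
pose M := idealr_of iE E1.
have inM x : (x \in M) <-> expand P x by rewrite in_idealr_of; split => /asboolP.
exists M; split.
  split.
    apply/maximal_idealP; split; [exact: idealr_ideal | exact: idealr_proper |].
    move=> K iK K1 MK x Kx; apply/inM; apply: Emax Kx => // y Ey.
    by move/inM: Ey; exact: MK.
  move=> N /maximal_idealP[iN N1 Nmax] x; apply/idP/idP.
    by move/(proper_sub_expand iN N1)/inM.
  by move/inM; apply: (Nmax _ iE E1); exact: proper_sub_expand.
exists d; split.
  by rewrite /has_krull_dim !prime_chainP !localization_prime_chain.
split.
  exists (map pi l); split; last by rewrite size_map.
    apply/regular_sequenceP; split; first exact: regular_expand contracts0 regl.
    rewrite gen_seqE => H; apply: (E1).
    apply: (ideal_gen_min iE _ H) => _ /mapP[r /lP Pr ->].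
    exact/(expandE _ pP).
  by move=> _ /mapP[r /lP Pr ->]; apply/inM/(expandE _ pP).
move=> s /regular_sequenceP[regs _] sM.
have [|l' [<- l'P regl']] := regular_contract contracts0 _ regs.
  move=> a /sM/inM aM [y ay]; apply: (E1).
  by rewrite -ay; exact: idealMl.
rewrite leqNgt; apply/negP => dl; apply: ncd.
exact: prime_chain_between_leq dl (regular_prime_chain noe pP iJ JP l'P regl').
Qed.

End Localization.

(** * Quotients followed by localization *)

Section LocalizationMap.

Variables (A : comNzRingType) (p : prime_idealr A).

Definition loc_map (a : A) : localization p := \pi_(localization p) (loc_const p a).

Lemma loc_map_zmod_morphism : zmod_morphism loc_map.
Proof.
move=> a b; rewrite /loc_map.
transitivity (\pi_(localization p)
  (loc_add_frac (loc_const p a) (loc_opp_frac (loc_const p b)))).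
  apply/eqmodP/loc_equivP; exists 1; first exact: prime_notin1.
  by rewrite /=; ring.
by rewrite loc_pi_add loc_pi_opp.
Qed.

Lemma loc_map_monoid_morphism : monoid_morphism loc_map.
Proof.
split; first by rewrite /loc_map -[RHS]/(loc_one p) /loc_one -lock.
move=> a b; rewrite /loc_map -[RHS]loc_pi_mul.
apply/eqmodP/loc_equivP; exists 1; first exact: prime_notin1.
by rewrite /=; ring.
Qed.

HB.instance Definition _ :=
  GRing.isZmodMorphism.Build A (localization p) loc_map loc_map_zmod_morphism.
HB.instance Definition _ :=
  GRing.isMonoidMorphism.Build A (localization p) loc_map loc_map_monoid_morphism.

Lemma loc_map_eq0 a : loc_map a = 0 <-> exists2 s, s \notin p & s * a = 0.
Proof.
rewrite -(rmorph0 loc_map) /loc_map; split.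
  move=> /eqmodP/loc_equivP[s sp /=]; rewrite mulr1 mul0r mulr0 => sa.
  by exists s.
case=> s sp sa; apply/eqmodP/loc_equivP; exists s => //=.
by rewrite mulr1 mul0r mulr0.
Qed.

Lemma loc_map_frac (x : localization p) :
  exists a s, s \notin p /\ loc_map s * x = loc_map a.
Proof.
elim/quotW: x => x; exists x.1, x.2; split; first exact: loc_frac_den.
rewrite /loc_map -[LHS]loc_pi_mul.
apply/eqmodP/loc_equivP; exists 1; first exact: prime_notin1.
by rewrite /=; ring.
Qed.

Lemma loc_map_unit s : s \notin p -> exists y, loc_map s * y = 1.
Proof.
move=> sp; exists (\pi_(localization p) (@LocFrac _ p (1, s) sp)).
rewrite -(rmorph1 loc_map) /loc_map -[LHS]loc_pi_mul.
apply/eqmodP/loc_equivP; exists 1; first exact: prime_notin1.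
by rewrite /=; ring.
Qed.

End LocalizationMap.

Section Surjection.

Variables (R A : comNzRingType) (q : {rmorphism R -> A}) (J : R -> Prop).
Hypotheses (q_surj : forall x, exists r, q r = x) (qJ : forall r, q r = 0 <-> J r).

Lemma surjection_localization (p : prime_idealr A) :
  is_localization (loc_map p \o q) J (fun r => q r \in p).
Proof.
split=> [x|s /negP/loc_map_unit//|r].
  have [a [s [sp sx]]] := loc_map_frac x.
  have [r ra] := q_surj a; have [t ts] := q_surj s.
  by exists r, t; rewrite /= ra ts; split=> //; exact/negP.
split=> [/loc_map_eq0[s sp sr]|[s /negP sp /qJ sr]].
  have [t ts] := q_surj s; exists t; first by rewrite ts; exact/negP.
  by apply/qJ; rewrite rmorphM ts.
by apply/loc_map_eq0; exists (q s) => //; rewrite -rmorphM.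
Qed.

Lemma contract_ideal (K : A -> Prop) : is_ideal K -> is_ideal (fun r => K (q r)).
Proof.
move=> iK; split; first by rewrite rmorph0; exact: ideal0.
- by move=> f g Kf Kg; rewrite rmorphD; exact: idealD.
- by move=> r f Kf; rewrite rmorphM; exact: idealM.
Qed.

Definition image (K : R -> Prop) x := exists2 r, q r = x & K r.

Lemma image_ideal K : is_ideal K -> is_ideal (image K).
Proof.
move=> iK; split.
- by exists 0; [rewrite rmorph0 | exact: ideal0].
- move=> _ _ [f <- Kf] [g <- Kg]; exists (f + g); first by rewrite rmorphD.
  exact: idealD.
- move=> x _ [f <- Kf]; have [r <-] := q_surj x.
  by exists (r * f); [rewrite rmorphM | exact: idealM].
Qed.

Lemma imageE K r : is_ideal K -> (forall f, J f -> K f) -> image K (q r) <-> K r.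
Proof.
move=> iK JK; split=> [[f /eqP]|Kr]; last by exists r.
rewrite eq_sym -subr_eq0 -rmorphB => /eqP/qJ/JK Kfr Kf.
by rewrite -(subrK f r); exact: idealD.
Qed.

Lemma image_prime P : is_prime P -> (forall f, J f -> P f) -> is_prime (image P).
Proof.
move=> [iP P1 PM] JP; split; first exact: image_ideal.
  by rewrite -(rmorph1 q) imageE.
move=> x y; have [f <-] := q_surj x; have [g <-] := q_surj y.
by rewrite -rmorphM !imageE //; exact: PM.
Qed.

Lemma image_maximal P : is_maximal P -> (forall f, J f -> P f) ->
  is_maximal (image P).
Proof.
move=> [iP P1 Pmax] JP; split; first exact: image_ideal.
  by rewrite -(rmorph1 q) imageE.
move=> K iK K1 PK x; have [f <-] := q_surj x => Kf; apply/imageE => //.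
apply: (Pmax _ (contract_ideal iK)) => //; first by rewrite rmorph1.
by move=> g Pg; apply: PK; exact/imageE.
Qed.

Lemma contract_maximal (p : A -> Prop) : is_maximal p ->
  is_maximal (fun r => p (q r)).
Proof.
move=> [ip p1 pmax]; have ic := contract_ideal ip; split=> //.
  by rewrite rmorph1.
move=> K iK K1 pK f Kf.
have JK g : J g -> K g by move=> /qJ qg; apply: pK; rewrite qg; exact: ideal0.
apply: (pmax _ (image_ideal iK)); last exact/imageE.
  by rewrite -(rmorph1 q) imageE.
by move=> x; have [g <-] := q_surj x => /pK Kg; exact/imageE.
Qed.

End Surjection.

Definition cohen_macaulay_at (R : comNzRingType) (J P : R -> Prop) := exists d,
  [/\ prime_chain_between J P d, ~ prime_chain_between J P d.+1 &
      exists l, [/\ size l = d, forall r, r \in l -> P r &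
                    regular (fun s => ~ P s) J l]].

Lemma cohen_macaulay_idealP (R : comNzRingType) (I : {pred R}) : noetherian R ->
  cohen_macaulay_ideal I <->
  [/\ is_ideal (fun f => f \in I), ~ 1 \in I & forall P : R -> Prop,
      is_maximal P -> is_prime P -> (forall f, f \in I -> P f) ->
      cohen_macaulay_at (fun f => f \in I) P].
Proof.
move=> noe.
pose q (J : idealr R) : {rmorphism R -> {ideal_quot J}} := \pi_{ideal_quot J}.
have piP (J : idealr R) r : q J r = 0 <-> r \in J.
  rewrite -(rmorph0 (q J)) -(subr0 r) /q /= Quotient.idealrBE subr0.
  by split=> /eqP.
have piS (J : idealr R) (x : {ideal_quot J}) : exists r, q J r = x.
  by exists (repr x); rewrite /q /= reprK.
split.
  case=> J /funext JI CM; have {JI} -> : I = (J : {pred R}) by exact/esym.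
  split; [exact: idealr_ideal | exact: idealr_proper |] => P mP pP JP.
  have mQ := image_maximal (piS J) (piP J) mP JP.
  have pQ := image_prime (piS J) (piP J) pP JP.
  (* The maximal ideals of R / J are the images of those of R that contain J. *)
pose p := prime_idealr_of pQ.
  have PE : (fun r => q J r \in p : Prop) = P.
    apply/funext => r; apply/propext; rewrite in_prime_idealr_of.
    rewrite -(imageE (piP J) r (prime_ideal pP) JP).
    by split=> /asboolP.
  have /CM : maximal_ideal p.
    apply/maximal_idealP.
    suff -> : (fun f => f \in (p : idealr _) : Prop) = image (q J) P by [].
    by apply/funext => x; apply/propext; rewrite in_prime_idealr_of; split=> /asboolP.
  have := surjection_localization (piS J) (piP J) p; rewrite PE => locP.
  by move/(local_cohen_macaulayP (idealr_ideal J) pP JP locP noe).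
case=> iI I1 CM; exists (idealr_of iI I1).
  by move=> f; rewrite in_idealr_of; exact: asboolb.
set J := idealr_of iI I1 => p mp.
have JE f : (f \in J) = (f \in I) by rewrite in_idealr_of asboolb.
have /maximal_idealP/(contract_maximal (piS J) (piP J)) := mp.
set P := (fun r : R => is_true _) => mP.
have locP := surjection_localization (piS J) (piP J) p.
have pP : is_prime P.
  split; [by case: mP | by case: mP |] => f g.
  by rewrite /P rmorphM prime_idealrM => /orP.
have JP f : f \in J -> P f.
  by move=> /piP fJ; rewrite /P fJ idealr0.
apply/(local_cohen_macaulayP (idealr_ideal J) pP JP locP noe).
have -> : (fun f => f \in J : Prop) = (fun f => f \in I).
  by apply/funext => f; rewrite JE.
by apply: CM => // f; rewrite -JE; exact: JP.
Qed.

(** * The Hilbert basis theorem for polynomials in n variables *)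

(** Beyond any index there is one where the minimum of the remaining values is
attained; iterate. *)
Lemma nondecreasing_subsequence (v : nat -> nat) : exists h : nat -> nat,
  {homo h : i j / (i < j)%N} /\ {homo (v \o h) : i j / (i <= j)%N}.
Proof.
have next N : exists i, (N <= i)%N /\ forall j, (i <= j)%N -> (v i <= v j)%N.
  have exv : exists y, `[< exists2 i, (N <= i)%N & v i = y >].
    by exists (v N); apply/asboolP; exists N.
  case: (ex_minnP exv) => y /asboolP[i Ni <-] ymin; exists i; split=> // j ij.
  by apply: ymin; apply/asboolP; exists j => //; exact: leq_trans ij.
have [p pP] := choice next.
pose h := fix h i := if i is j.+1 then p (h j).+1 else p 0%N.
have hS i : (h i < h i.+1)%N by case: (pP (h i).+1).
have hmin i j : (h i <= j)%N -> (v (h i) <= v j)%N.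
  by case: i => [|i] /= Hj; [case: (pP 0%N) | case: (pP (h i).+1)] => _; exact.
exists h; split; first exact: homo_ltn ltn_trans hS.
by apply: homo_leq => [||i]; [exact: leqnn | exact: leq_trans | exact/hmin/ltnW].
Qed.

(** Extract nondecreasing subsequences one coordinate after the other. *)
Lemma dickson n (u : nat -> 'X_{1..n}) : exists i j, (i < j)%N /\ (u i <= u j)%MM.
Proof.
suff H k : (k <= n)%N -> exists h : nat -> nat, {homo h : i j / (i < j)%N} /\
    forall i j (l : 'I_n), (i <= j)%N -> (l < k)%N -> (u (h i) l <= u (h j) l)%N.
  have [h [hmono hP]] := H n (leqnn n).
  exists (h 0%N), (h 1%N); split; first exact: hmono.
  by apply/mnm_lepP => l; exact: (hP 0%N 1%N l isT (ltn_ord l)).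
elim: k => [_|k IH kn]; first by exists id; split.
have [h [hmono hP]] := IH (ltnW kn).
have [g [gmono gP]] := nondecreasing_subsequence (fun i => u (h i) (Ordinal kn)).
exists (h \o g); split; first by move=> i j /gmono/hmono.
have gle : {homo g : i j / (i <= j)%N}.
  by move=> i j; rewrite leq_eqVlt => /predU1P[->//|/gmono/ltnW].
move=> i j l ij; rewrite ltnS leq_eqVlt => /predU1P[lk|lk].
  by rewrite (_ : l = Ordinal kn); [exact: gP | exact: val_inj].
by apply: hP => //; exact: gle.
Qed.

Section Hilbert.

Variables (k : fieldType) (n : nat).
Implicit Types (f g h : {mpoly k[n]}) (K : {mpoly k[n]} -> Prop).

(** One step of multivariate division. *)
Lemma reduce_lead f h : h != 0 -> (mlead h <= mlead f)%MM ->
  exists r, f - r * h = 0 \/ (mlead (f - r * h) < mlead f)%O.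
Proof.
move=> h0 hf; pose c := f@_(mlead f) / h@_(mlead h).
pose r := c *: 'X_[mlead f - mlead h] : {mpoly k[n]}; exists r.
have hc : h@_(mlead h) != 0 by rewrite mleadc_eq0.
have rE : mlead f = ((mlead f - mlead h) + mlead h)%MM by rewrite submK.
have lead0 : (f - r * h)@_(mlead f) = 0.
  rewrite mcoeffB [X in _ - _@_X]rE /r -scalerAl mcoeffZ (mulrC 'X_[_]).
  by rewrite mcoeffMX /c divfK// subrr.
have [E|q0] := eqVneq (f - r * h) 0; [by left | right].
rewrite lt_neqAle; apply/andP; split.
  by apply: contra_neqN q0 => /eqP E; rewrite -E in lead0; apply/eqP; rewrite -mleadc_eq0 lead0.
apply: (le_trans (mleadB_le _ _)).
rewrite leUx lexx /=.
apply: (le_trans (mleadM_le _ _)).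
rewrite rE lem_add//.
by apply: (le_trans (mleadZ_le _ _)); rewrite mleadXm.
Qed.

(** If [K] is smaller than [K'], some element of [K'] has a leading monomial that
is a multiple of none from [K]: otherwise division by elements of [K] would
terminate and show that [K'] is contained in [K]. *)
Lemma new_lead K K' : is_ideal K -> is_ideal K' -> (forall f, K f -> K' f) ->
  (exists2 f, K' f & ~ K f) -> exists2 f, K' f /\ ~ K f &
    forall h, K h -> h != 0 -> ~ (mlead h <= mlead f)%MM.
Proof.
move=> iK iK' KK' [f0 K'f0 nKf0]; apply: contrapT => H; apply: nKf0.
have [M E] : exists M, M = mlead f0 by exists (mlead f0).
elim/(well_founded_ind (@ltom_wf n)): M f0 E K'f0 => M IH f E K'f.
apply: contrapT => nKf; apply: H; exists f => // h Kh h0 hf.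
have [r Hr] := reduce_lead h0 hf; apply: nKf.
rewrite -(subrK (r * h) f); apply: idealD => //; last exact: idealM.
case: Hr => [->|lt]; first exact: ideal0.
apply: (IH (mlead (f - r * h))) => //; first by rewrite E.
by apply: idealB => //; apply: idealM => //; exact: KK'.
Qed.

(** A strictly increasing sequence of ideals would, by [new_lead], yield a sequence
of monomials none of which divides a later one, against [dickson]. *)
Theorem hilbert_basis : noetherian {mpoly k[n]}.
Proof.
move=> C [K0 CK0] Cid; apply: contrapT => noMax.
have step (K : {K | C K}) : exists K' : {K | C K},
    (forall f, sval K f -> sval K' f) /\ exists2 f, sval K' f & ~ sval K f.
  case: K => K CK; apply: contrapT => H; apply: noMax; exists K => // K' CK' KK' f K'f.
  by apply: contrapT => nKf; apply: H; exists (exist _ K' CK'); split=> //; exists f.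
have [nxt nxtP] := choice step.
pose c i := iter i nxt (exist _ K0 CK0).
have ic i : is_ideal (sval (c i)) by exact: Cid (svalP (c i)).
have cle i j : (i <= j)%N -> forall f, sval (c i) f -> sval (c j) f.
  elim: j => [|j IH]; first by rewrite leqn0 => /eqP->.
  rewrite leq_eqVlt => /predU1P[->//|ij] f /(IH ij).
  by case: (nxtP (c j)) => + _; apply.
(* The sequence of monomials to which Dickson's lemma applies. *)
have lead i : exists f, [/\ sval (c i.+1) f, f != 0 &
    forall h, sval (c i) h -> h != 0 -> ~ (mlead h <= mlead f)%MM].
  have [sub ex] := nxtP (c i).
  have [f [Kf nKf] fP] := new_lead (ic i) (ic i.+1) sub ex.
  by exists f; split=> //; apply/eqP => f0; apply: nKf; rewrite f0; exact: ideal0.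
have [g gP] := choice lead.
have [i [j [ij le]]] := dickson (fun i => mlead (g i)).
have [ci gi _] := gP i; have [_ _ H] := gP j.
by apply: (H (g i)) => //; exact: cle ci.
Qed.

End Hilbert.

(** * Symbolic powers as monomial ideals *)

Section SymbolicPowers.

Variables (k : fieldType) (n : nat).
Local Notation S := {mpoly k[n]}.
Implicit Types (f g h : S) (F : {set 'I_n}) (D : {set {set 'I_n}})
  (a b w : 'X_{1..n}) (K P Q : S -> Prop).

(** The order of vanishing of the monomial x^a along the linear subspace on which
all variables outside [F] vanish. *)
Definition codeg F a := (\sum_(i | i \notin F) a i)%N.

Lemma codegD F a b : codeg F (a + b)%MM = (codeg F a + codeg F b)%N.
Proof. by rewrite /codeg -big_split; apply: eq_bigr => i _; rewrite mnmDE. Qed.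

Definition order_ge F t f := forall a, a \in msupp f -> (t <= codeg F a)%N.

Lemma order_geM F s t f g : order_ge F s f -> order_ge F t g ->
  order_ge F (s + t) (f * g).
Proof.
move=> fs gt a /msuppM_le/allpairsP[[b c] /= [/fs bs /gt ct ->]].
by rewrite codegD leq_add.
Qed.

Lemma order_ge_leq F s t f : (s <= t)%N -> order_ge F t f -> order_ge F s f.
Proof. by move=> st ft a /ft; exact: leq_trans. Qed.

Lemma order_ge0 F f : order_ge F 0 f. Proof. by []. Qed.

Lemma order_geX F i : i \notin F -> order_ge F 1 'X_i.
Proof.
move=> iF a; rewrite msuppX inE => /eqP->.
by rewrite /codeg (bigD1 i)//= mnm1E eqxx.
Qed.

Lemma order_ge_ideal F t : is_ideal (order_ge F t).
Proof.
split; first by move=> a; rewrite msupp0.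
- by move=> f g ft gt a /msuppD_le; rewrite mem_cat => /orP[/ft|/gt].
- by move=> r f ft; exact: (order_geM (@order_ge0 F r) ft).
Qed.

Lemma order_geXn F t f : order_ge F 1 f -> order_ge F t (f ^+ t).
Proof.
move=> f1; elim: t => [|t IH]; first exact: order_ge0.
by rewrite exprS -add1n; exact: order_geM.
Qed.

Lemma ideal_sum K (I : Type) (r : seq I) (p : pred I) (E : I -> S) :
  is_ideal K -> (forall i, p i -> K (E i)) -> K (\sum_(i <- r | p i) E i).
Proof.
move=> iK H; elim/big_ind: _ => //; [exact: ideal0 | by move=> x y; exact: idealD].
Qed.

Lemma ideal_msupp K f : is_ideal K -> (forall a, a \in msupp f -> K 'X_[a]) -> K f.
Proof.
move=> iK H; rewrite [f]mpolyE big_seq; apply: ideal_sum => // a /H Ka.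
by rewrite -mul_mpolyC; exact: idealM.
Qed.

Lemma monomial_factors F t a : (t <= codeg F a)%N ->
  exists r (s : t.-tuple S), {subset s <= @face_prime k n F} /\
    'X_[a] = r * \prod_(x <- s) x.
Proof.
elim: t a => [|t IH] a ta.
  by exists 'X_[a], [tuple]; split=> //; rewrite big_nil mulr1.
have [i iF ai] : exists2 i, i \notin F & (0 < a i)%N.
  apply: contrapT => H; move: ta; rewrite /codeg big1// => i iF.
  by apply/eqP; rewrite -leqn0 leqNgt; apply/negP => ai; apply: H; exists i.
have ia : (U_(i) <= a)%MM.
  by apply/mnm_lepP => j; rewrite mnm1E; case: eqP => // <-.
have E : codeg F U_(i) = 1%N.
  rewrite /codeg (bigD1 i)//= mnm1E eqxx big1// => j /andP[_ /negbTE ji].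
  by rewrite mnm1E eq_sym ji.
have [|r [s [sF Es]]] := IH (a - U_(i))%MM.
  by move: ta; rewrite -{1}(submK ia) codegD E addn1 ltnS.
exists r, [tuple of 'X_i :: s]; split.
  move=> x; rewrite in_cons => /predU1P[->|/sF//].
  by apply: ideal_gen_sub; exists i.
by rewrite big_cons mulrCA -Es -mpolyXD addmC submK.
Qed.

Lemma ideal_pow_face_prime F t f :
  f \in ideal_pow (@face_prime k n F) t <-> order_ge F t f.
Proof.
split.
  apply: ideal_gen_min; first exact: order_ge_ideal.
  move=> _ [s sF ->].
  have {sF} : forall x, x \in (s : seq S) -> order_ge F 1 x.
    move=> x /sF; apply: ideal_gen_min; first exact: order_ge_ideal.
    by move=> _ [i iF ->]; exact: order_geX.
  rewrite -{2}(size_tuple s); elim: (s : seq S) => [_|x l IH sP].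
    by rewrite big_nil; exact: order_ge0.
  rewrite big_cons /= -add1n; apply: order_geM; first by apply: sP; exact: mem_head.
  by apply: IH => y yl; apply: sP; rewrite in_cons yl orbT.
move=> ft; apply: (ideal_msupp (ideal_gen_ideal _)) => a /ft ta.
have [r [s [sF ->]]] := monomial_factors ta.
have [_ _ iM] := ideal_gen_ideal (fun g : S => exists2 s : t.-tuple S,
  {subset s <= face_prime F} & g = \prod_(x <- s) x).
by apply: iM; apply: ideal_gen_sub; exists s.
Qed.

Lemma symbolic_powerP D t f : f \in @symbolic_power k n D t <->
  forall F, F \in facets D -> order_ge F t f.
Proof.
split=> [/forallP H F FD|H].
  by apply/ideal_pow_face_prime; move: (H F); rewrite FD.
by apply/forallP => F; apply/implyP => /H; move/ideal_pow_face_prime.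
Qed.

Lemma symbolic_power_ideal D t : is_ideal (fun f => f \in @symbolic_power k n D t).
Proof.
split.
- by apply/symbolic_powerP => F _; exact: ideal0 (order_ge_ideal F t).
- move=> f g /symbolic_powerP ft /symbolic_powerP gt; apply/symbolic_powerP => F FD.
  by apply: (idealD (order_ge_ideal F t)); [exact: ft | exact: gt].
- move=> r f /symbolic_powerP ft; apply/symbolic_powerP => F FD.
  by apply: (idealM _ (order_ge_ideal F t)); exact: ft.
Qed.

Lemma symbolic_power_proper D t : set0 \in D -> (0 < t)%N ->
  ~ 1 \in @symbolic_power k n D t.
Proof.
move=> D0 t0 /symbolic_powerP.
have [F maxF _] := maxset_exists (P := mem D) D0.
move=> /(_ F); rewrite inE => /(_ maxF 0%MM).
rewrite -mpolyC1 msupp1 mem_head => /(_ isT).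
by rewrite /codeg big1 => [|i _]; [rewrite leqNgt t0 | rewrite mnm0E].
Qed.

(** Both powers have the same radical: if f lies in the s-th symbolic power with
s > 0, then f^t lies in the t-th. *)
Lemma prime_symbolic_power D s t Q : is_prime Q -> (0 < s)%N -> 
  (forall f, f \in @symbolic_power k n D t -> Q f) ->
  forall f, f \in @symbolic_power k n D s -> Q f.
Proof.
move=> pQ s0 H f /symbolic_powerP fs; have [_ Q1 QM] := pQ.
have : Q (f ^+ t).
  apply: H; apply/symbolic_powerP => F FD; apply: order_geXn.
  exact: order_ge_leq s0 (fs F FD).
by elim: (t) => [|j IH]; rewrite ?expr0// exprS => /QM[].
Qed.

Lemma prime_monomial Q a : is_prime Q -> Q 'X_[a] <-> exists2 i, Q 'X_i & (0 < a i)%N.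
Proof.
move=> [iQ Q1 QM]; split.
  rewrite mpolyXE_id => H; apply: contrapT => nE; move: H.
  apply: (big_ind (fun x => ~ Q x)) => // [x y Qx Qy /QM[]//|i _].
  have [ai|ai] := posnP (a i); first by rewrite ai expr0.
  have Qi : ~ Q 'X_i by move=> Qi; apply: nE; exists i.
  by elim: (a i) => [|j IH]; rewrite ?expr0// exprS => /QM[].
case=> i Qi ai; rewrite -(submK (m := U_(i)%MM) (m' := a)).
  by rewrite mpolyXD; exact: idealM.
by apply/mnm_lepP => j; rewrite mnm1E; case: eqP => // <-.
Qed.

End SymbolicPowers.

(** * Dilating the variables that lie in a prime *)

Section Dilation.

Variables (k : fieldType) (n : nat).
Local Notation S := {mpoly k[n]}.
Variables (P : S -> Prop) (q : nat).
Hypotheses (pP : is_prime P) (q_gt0 : (0 < q)%N).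
Let U f := ~ P f.
Let mU : mult_set U := prime_compl pP.
Implicit Types (f g h : S) (F : {set 'I_n}) (D : {set {set 'I_n}})
  (a b w : 'X_{1..n}) (K Q : S -> Prop).

(** Variables outside [P] are left alone: this makes [P] the only prime over its
image, see [prime_over_dilation]. *)
Definition expo (i : 'I_n) := if `[< P 'X_i >] then q else 1%N.

Definition dilate a := [multinom (a i * expo i)%N | i < n].

Definition dilatable b := [forall i, expo i %| b i]%N.

Definition shrink b := [multinom (b i %/ expo i)%N | i < n].

Definition dilate_poly f : S := f \mPo [tuple 'X_i ^+ expo i | i < n].

Lemma dilate_poly_zmod_morphism : zmod_morphism dilate_poly.
Proof. by move=> f g; rewrite /dilate_poly rmorphB. Qed.

Lemma dilate_poly_monoid_morphism : monoid_morphism dilate_poly.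
Proof. by split=> [|f g]; rewrite /dilate_poly ?rmorph1 ?rmorphM. Qed.

HB.instance Definition _ :=
  GRing.isZmodMorphism.Build S S dilate_poly dilate_poly_zmod_morphism.
HB.instance Definition _ :=
  GRing.isMonoidMorphism.Build S S dilate_poly dilate_poly_monoid_morphism.

(** The projection of S onto the image of [dilate_poly], read in the coordinates
of its source. *)
Definition shrink_poly f : S :=
  \sum_(b <- msupp f | dilatable b) f@_b *: 'X_[shrink b].

Lemma expo_gt0 i : (0 < expo i)%N. Proof. by rewrite /expo; case: ifP. Qed.

Lemma expo_in i : P 'X_i -> expo i = q.
Proof. by rewrite /expo => /asboolP ->. Qed.

Lemma expo_notin i : ~ P 'X_i -> expo i = 1%N.
Proof. by rewrite /expo => /asboolPn/negbTE ->. Qed.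

Lemma dilatableE b a : dilatable b && (shrink b == a) = (b == dilate a).
Proof.
apply/andP/eqP => [[/forallP dv /eqP <-]|->]; last split.
- by apply/mnmP => i; rewrite !mnmE divnK.
- by apply/forallP => i; rewrite mnmE dvdn_mull.
- by apply/eqP/mnmP => i; rewrite !mnmE mulnK// expo_gt0.
Qed.

Lemma shrink_poly_coef f a : (shrink_poly f)@_a = f@_(dilate a).
Proof.
rewrite /shrink_poly raddf_sum /= [in RHS](mpolyE f) raddf_sum /= big_mkcond.
apply: eq_bigr => b _; rewrite !mcoeffZ !mcoeffX -dilatableE.
by case: dilatable => //=; rewrite mulr0.
Qed.

Lemma shrink_poly_zmod_morphism : zmod_morphism shrink_poly.
Proof. by move=> f g; apply/mpolyP => a; rewrite !(shrink_poly_coef, mcoeffB). Qed.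

HB.instance Definition _ :=
  GRing.isZmodMorphism.Build S S shrink_poly shrink_poly_zmod_morphism.

Lemma psiZ c f : shrink_poly (c *: f) = c *: shrink_poly f.
Proof. by apply/mpolyP => a; rewrite !(shrink_poly_coef, mcoeffZ). Qed.

Lemma dilateD a b : dilate (a + b) = (dilate a + dilate b)%MM.
Proof. by apply/mnmP => i; rewrite !mnmE mulnDl. Qed.

Lemma dilate_poly_mpolyX a : dilate_poly 'X_[a] = 'X_[dilate a].
Proof.
rewrite /dilate_poly comp_mpolyX (mpolyXE_id _ (dilate a)); apply: eq_bigr => i _.
by rewrite tnth_mktuple mnmE mulnC exprM.
Qed.

Lemma mpolyXM_coef a b g : ('X_[a] * g)@_b = if (a <= b)%MM then g@_(b - a) else 0.
Proof.
rewrite mulrC; case: ifPn => [ab|nab]; first by rewrite -{1}(submK ab) addmC mcoeffMX.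
apply/eqP; rewrite mcoeff_eq0 (perm_mem (msuppMX _ _)); apply: contra nab.
by move=> /mapP[c _ ->]; exact: lem_addr.
Qed.

(** It suffices to take f to be a monomial x^a.  Dilation preserves and reflects
divisibility of monomials, so the coefficients of both sides agree. *)
Lemma shrink_dilateM f g : shrink_poly (dilate_poly f * g) = f * shrink_poly g.
Proof.
elim/mpolyind: f => [|c a f _ _ IH]; first by rewrite rmorph0 !mul0r raddf0.
rewrite rmorphD !mulrDl raddfD /= IH; congr (_ + _).
rewrite [dilate_poly (c *: _)]comp_mpolyZ -!scalerAl psiZ; congr (_ *: _).
rewrite -/(dilate_poly _) dilate_poly_mpolyX; apply/mpolyP => b.
rewrite shrink_poly_coef !mpolyXM_coef shrink_poly_coef.
have -> : (dilate a <= dilate b)%MM = (a <= b)%MM.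
  apply/mnm_lepP/mnm_lepP => H i; have := H i; rewrite !mnmE leq_pmul2r//;
  exact: expo_gt0.
case: ifP => // ab; congr (_@_ _); apply: (@addIm _ (dilate a)).
rewrite -dilateD !submK//; apply/mnm_lepP => i; rewrite !mnmE leq_mul2r.
by rewrite (mnm_lepP ab) orbT.
Qed.

Lemma shrink_dilate f : shrink_poly (dilate_poly f) = f.
Proof.
rewrite -[dilate_poly f]mulr1 shrink_dilateM -[RHS]mulr1; congr (_ * _).
apply/mpolyP => a; rewrite shrink_poly_coef !mcoeff1; congr (nat_of_bool _)%:R.
apply/eqP/eqP => [|->]; last by apply/mnmP => i; rewrite mnmE mnm0E.
move=> /mnmP H; apply/mnmP => i; have := H i; rewrite !mnmE => /eqP.
by rewrite muln_eq0 (gtn_eqF (expo_gt0 i)) orbF => /eqP.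
Qed.

Lemma dilate_poly_coef f a : (dilate_poly f)@_(dilate a) = f@_a.
Proof. by rewrite -shrink_poly_coef shrink_dilate. Qed.

Lemma dilate_poly_msupp f b : b \in msupp (dilate_poly f) ->
  exists2 a, a \in msupp f & b = dilate a.
Proof.
rewrite [dilate_poly f]comp_mpolyEX => bf.
have /flattenP[_ /mapP[a + ->] /msuppZ_le] := msupp_sum_le bf.
rewrite filter_predT => af.
by rewrite -/(dilate_poly _) dilate_poly_mpolyX msuppX inE => /eqP->; exists a.
Qed.

Lemma dilate_fixed a : (forall i, P 'X_i -> a i = 0%N) -> dilate a = a.
Proof.
move=> Pa; apply/mnmP => i; rewrite mnmE.
have [/[dup]/Pa -> |/expo_notin->] := pselect (P 'X_i); first by rewrite mul0n.
by rewrite muln1.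
Qed.

(** The ideal generated by the variables in [P] consists of the polynomials without
monomials in the other variables only. *)
Lemma prime_off_fixed Q h : is_prime Q -> (forall i, P 'X_i -> Q 'X_i) ->
  (forall a, (forall i, P 'X_i -> a i = 0%N) -> h@_a = 0) -> Q h.
Proof.
move=> pQ PQ h0; apply: (ideal_msupp (prime_ideal pQ)) => a.
rewrite mcoeff_msupp => /eqP ha; apply/(prime_monomial _ pQ).
apply: contrapT => nE; apply: ha; apply: h0 => i Pi; apply/eqP.
rewrite -leqn0 leqNgt; apply/negP => ai; apply: nE; exists i => //; exact: PQ.
Qed.

Lemma dilate_poly_mod f : P (dilate_poly f - f).
Proof.
apply: prime_off_fixed => // a /dilate_fixed da.
by rewrite mcoeffB -{1}da dilate_poly_coef subrr.
Qed.

Lemma shrink_poly_mod f : P (shrink_poly f - f).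
Proof.
apply: prime_off_fixed => // a /dilate_fixed da.
by rewrite mcoeffB shrink_poly_coef da subrr.
Qed.

Lemma prime_congr f g : P (f - g) -> P f <-> P g.
Proof.
have iP := prime_ideal pP; move=> fg; split=> H.
  by rewrite -(subKr f g); exact: idealB.
by rewrite -(subrK g f); exact: idealD.
Qed.

Lemma dilate_poly_prime f : P (dilate_poly f) <-> P f.
Proof. exact/prime_congr/dilate_poly_mod. Qed.

Lemma shrink_poly_prime f : P (shrink_poly f) <-> P f.
Proof. exact/prime_congr/shrink_poly_mod. Qed.

(** Such a [Q] contains the variables in [P], as it contains their powers, and
modulo these variables both maps are the identity. *)
Lemma prime_over_dilation Q : is_prime Q -> (forall f, P f -> Q (dilate_poly f)) ->
  forall f, P f -> Q f.
Proof.
move=> pQ PQ f Pf; have [iQ Q1 QM] := pQ.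
rewrite -(subrK (dilate_poly (shrink_poly f)) f); apply: idealD => //.
  apply: prime_off_fixed => // [i /PQ|a /dilate_fixed da].
    rewrite [dilate_poly _]comp_mpolyXU (nth_map i) ?size_enum_ord// nth_ord_enum.
    by elim: expo => [|j IH]; rewrite ?expr0// exprS => /QM[].
  by rewrite mcoeffB -{2}da dilate_poly_coef shrink_poly_coef da subrr.
by apply: PQ; apply/shrink_poly_prime.
Qed.

(** Facets F with P_F not contained in [P] impose no condition near [P]: a high
power of the product of the variables outside [P] lies in all powers of such
P_F. *)
Lemma sat_symbolic_power D t f :
  (forall F, F \in facets D -> (forall i, i \notin F -> P 'X_i) -> order_ge F t f) ->
  sat U (fun g => g \in @symbolic_power k n D t) f.
Proof.
move=> H; pose w : 'X_{1..n} := [multinom if `[< P 'X_i >] then 0%N else t | i < n].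
(* w_i = 0 exactly for the variables in P, so x^w is outside P. *)
exists 'X_[w].
  by move=> /(prime_monomial _ pP)[i /asboolP Pi]; rewrite mnmE Pi.
apply/symbolic_powerP => F FD a; rewrite mulrC (perm_mem (msuppMX _ _)).
move=> /mapP[b bf ->]; rewrite codegD.
have [/(H F FD)/(_ b bf)|/existsNP[i]] := pselect (forall i, i \notin F -> P 'X_i).
  by move=> tb; exact: leq_trans (leq_addl _ _).
move=> /not_implyP[iF /asboolPn/negbTE Pi].
by rewrite /codeg (bigD1 i)//= mnmE Pi -!addnA leq_addr.
Qed.

Lemma codeg_dilate F a : (forall i, i \notin F -> P 'X_i) ->
  codeg F (dilate a) = (q * codeg F a)%N.
Proof.
move=> FP; rewrite /codeg big_distrr /=; apply: eq_bigr => i /FP Pi.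
by rewrite mnmE expo_in// mulnC.
Qed.

Lemma dilate_poly_symbolic_power D m t f : (t <= q * m)%N ->
  f \in @symbolic_power k n D m ->
  sat U (fun g => g \in @symbolic_power k n D t) (dilate_poly f).
Proof.
move=> tqm /symbolic_powerP fm; apply: sat_symbolic_power => F FD FP b.
move=> /dilate_poly_msupp[a /(fm F FD) ma ->]; rewrite codeg_dilate//.
by apply: leq_trans tqm _; rewrite leq_mul2l ma orbT.
Qed.

Lemma shrink_poly_symbolic_power D m t f : (q * (m - 1) < t)%N ->
  f \in @symbolic_power k n D t ->
  sat U (fun g => g \in @symbolic_power k n D m) (shrink_poly f).
Proof.
move=> qmt /symbolic_powerP ft; apply: sat_symbolic_power => F FD FP a.
rewrite mcoeff_msupp shrink_poly_coef -mcoeff_msupp => /(ft F FD); rewrite codeg_dilate//.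
move=> tq; have := leq_trans qmt tq; rewrite ltn_mul2l q_gt0 /=; lia.
Qed.

Lemma map_preimage (l : seq S) :
  (forall f, f \in l -> exists2 g, P g & f = dilate_poly g) ->
  exists2 l', map dilate_poly l' = l & forall g, g \in l' -> P g.
Proof.
elim: l => [|f l IH] H; first by exists [::].
have [g Pg ->] := H f (mem_head _ _).
have [|l' <- l'P] := IH; first by move=> h hl; apply: H; rewrite in_cons hl orbT.
by exists (g :: l') => // h; rewrite in_cons => /predU1P[->|/l'P].
Qed.

Lemma regular_symbolic_power D m t (l : seq S) :
  (q * (m - 1) < t)%N -> (t <= q * m)%N -> (forall f, f \in l -> P f) ->
  regular U (fun f => f \in @symbolic_power k n D t) l ->
  exists l', [/\ size l' = size l, forall f, f \in l' -> P f &
                 regular U (fun f => f \in @symbolic_power k n D m) l'].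
Proof.
move=> qmt tqm lP regl; have iP := prime_ideal pP.
pose T f := exists2 g, P g & f = dilate_poly g.
have [||||l1 [sl1 l1T regl1]] := @regular_in_subset _ (@hilbert_basis k n) P pP T
    _ l _ _ _ _ (symbolic_power_ideal k D t) regl lP.
- by move=> _ _ [f Pf ->] [g Pg ->]; exists (f + g); [exact: idealD | rewrite rmorphD].
- by move=> _ _ [f Pf ->] [g Pg ->]; exists (f * g); [exact: idealM | rewrite rmorphM].
- by exists (dilate_poly 0), 0 => //; exact: ideal0.
- move=> Q pQ TQ; apply: prime_over_dilation => // f Pf; apply: TQ; by exists f.
have [l' El' l'P] := map_preimage l1T.
exists l'; split=> //; first by rewrite -sl1 -El' size_map.
apply: (@regular_retract _ U dilate_poly shrink_poly _ _ l' mU (symbolic_power_ideal k D t)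
  (symbolic_power_ideal k D m)).
- exact: rmorphM.
- exact: shrink_dilateM.
- by move=> s Us /dilate_poly_prime.
- by move=> s Us /shrink_poly_prime.
- by move=> f; exact: dilate_poly_symbolic_power.
- by move=> f; exact: shrink_poly_symbolic_power.
- by rewrite El'.
Qed.

End Dilation.

(** For t <= (m - 1) m the factor m - 1 works, by the lower bound on t.  For larger
t the least q with t <= q m satisfies q >= m, so that
q (m - 1) <= (t + m - 1) - m < t. *)
Lemma dilation_factor m t : (0 < m)%N -> ((m - 1) ^ 2 + 1 <= t)%N ->
  exists q, [/\ (0 < q)%N, (q * (m - 1) < t)%N & (t <= q * m)%N].
Proof.
move=> m0 mt; have [tm|mt'] := leqP t ((m - 1) * m).
  (* t > (m - 1)^2 is exactly q (m - 1) < t for q = m - 1. *)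
  by exists (m - 1)%N; split; nia.
exists ((t + m - 1) %/ m)%N.
have E := divn_eq (t + m - 1) m; have := ltn_pmod (t + m - 1) m0.
move: (_ %/ _)%N (_ %% _)%N E => q r E rm; have qm : (m <= q)%N by nia.
by split; nia.
Qed.

Theorem theorem4p3 (k : fieldType) (n : nat) (D : {set {set 'I_n}}) (m : nat)
    (hD : simplicial_complex D) (hm : (1 <= m)%N)
    (ht : exists2 t : nat, ((m - 1) ^ 2 + 1 <= t)%N &
            cohen_macaulay_ideal (@symbolic_power k n D t)) :
  cohen_macaulay_ideal (@symbolic_power k n D m).
Proof.
have noe := @hilbert_basis k n.
case: ht => t mt /(cohen_macaulay_idealP _ noe)[_ _ CMt].
have [q [q0 qmt tqm]] := dilation_factor hm mt.
have t0 : (0 < t)%N by lia.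
have radE Q : is_prime Q -> (forall f, f \in @symbolic_power k n D t -> Q f) <->
                            (forall f, f \in @symbolic_power k n D m -> Q f).
  by move=> pQ; split; exact: prime_symbolic_power.
apply/(cohen_macaulay_idealP _ noe); split.
- exact: symbolic_power_ideal.
- by apply: symbolic_power_proper => //; case: hD.
move=> P mP pP /(radE P pP) PI; have [d [cd ncd [l [sl lP regl]]]] := CMt P mP pP PI.
have chainE e : prime_chain_between (fun f => f \in @symbolic_power k n D t) P e <->
                prime_chain_between (fun f => f \in @symbolic_power k n D m) P e.
  split=> -[c [cP cS]]; exists c; split=> // i /cP[pc /(radE _ pc) Ic cP'];
  by split.
exists d; split; [exact/chainE | by move/chainE |].
rewrite -sl; exact: (regular_symbolic_power pP q0 qmt tqm lP regl).
Qed.
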